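(* Let $\mathcal M$ be an ordered group reduct of an o-minimal trace. Then $\mathrm{Th}(\mathcal M)$ does not have atomic models over arbitrary sets.
   Context: A structure $\mathcal M$ is an o-minimal trace if there exists an o-minimal expansion $\mathcal N_0$ of a group, in a language $\mathcal L_0$, such that $M\subsetneq N_0$ is dense in $N_0$, $\mathcal M|\mathcal L_0\prec\mathcal N_0$, and $\mathcal M$ is the structure induced on $M$ from $\mathcal N_0$; in other words, $\mathcal M$ is $\mathcal M|\mathcal L_0$ expanded by all sets $D\cap M^n$ with $D\subseteq N_0^n$ definable (with parameters) in $\mathcal N_0$. An ordered group reduct of a structure expanding an ordered group is a reduct in which the order and the group structure are preserved. All groups are assumed to be equipped with a constant $1>0$ in the language. A theory $T$ has atomic models over arbitrary sets if for every model $\mathcal M'\models T$ and every subset $A\subseteq M'$ there is a model of $\mathrm{Th}(\mathcal M',a)_{a\in A}$ that is atomic over $A$, i.e. in which every finite tuple has an isolated type over $A$.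
   Formalization: The formal theorem adds the assumption that M is not o-minimal; without it the claim fails, e.g. for the ordered group reduct (Q,<,+,0,1) of the trace of (R,<,+,0,1) on Q, and it fails for every o-minimal M, whose theory has definable Skolem functions. *)

(* Defs.v *)
From Stdlib Require List.
From mathcomp Require Import all_boot.

Set Implicit Arguments.
Unset Strict Implicit.
Unset Printing Implicit Defensive.

Record language := Language {
  fsym : nat -> Type;
  rsym : nat -> Type
}.

(* Terms and formulas are indexed by the type V of their free variables, so
   [formula L 'I_n] is the type of formulas in n free variables and
   [formula L void] that of sentences.  The quantifier binds the variable
   [None : option V]. *)
Inductive term (L : language) (V : Type) : Type :=
| Var of V
| App n of fsym L n & ('I_n -> term L V).

Inductive formula (L : language) (V : Type) : Type :=
| Bot
| Eq of term L V & term L V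
| Rel n of rsym L n & ('I_n -> term L V)
| Imp of formula L V & formula L V
| All of formula L (option V).

Definition sentence (L : language) := formula L void.

Record structure (L : language) := Structure {
  carrier :> Type;
  fint : forall n, fsym L n -> ('I_n -> carrier) -> carrier;
  rint : forall n, rsym L n -> ('I_n -> carrier) -> Prop
}.
Arguments fint {L} s {n} f x.
Arguments rint {L} s {n} r x.

Section Satisfaction.
Variables (L : language) (M : structure L).

Fixpoint eval (V : Type) (v : V -> M) (t : term L V) : M :=
  match t with
  | Var x => v x
  | App n f ts => fint M f (fun i => eval v (ts i))
  end.

Fixpoint sat (V : Type) (v : V -> M) (phi : formula L V) : Prop :=
  match phi with
  | Bot => False
  | Eq s t => eval v s = eval v t
  | Rel n r ts => rint M r (fun i => eval v (ts i))
  | Imp p q => sat v p -> sat v q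
  | All p => forall a : M, sat (oapp v a) p
  end.

Definition holds (phi : sentence L) : Prop := sat (of_void M) phi.

End Satisfaction.

Definition theory (L : language) := sentence L -> Prop.

Definition Th (L : language) (M : structure L) : theory L := holds M.

Definition models (L : language) (M : structure L) (T : theory L) : Prop :=
  forall phi, T phi -> holds M phi.

Definition elementary_embedding (L : language) (M N : structure L)
    (j : M -> N) : Prop :=
  forall n (phi : formula L 'I_n) (x : 'I_n -> M),
    sat x phi <-> sat (j \o x) phi.

Inductive const_sym (C : Type) : nat -> Type := Const of C : const_sym C 0.

Definition add_consts (L : language) (C : Type) : language :=
  Language (fun n => (fsym L n + const_sym C n)%type) (rsym L).

(* The expansion (M, c)_{c in C} of M. *)
Definition with_consts (L : language) (M : structure L) (C : Type) (e : C -> M) :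
    structure (add_consts L C) :=
  @Structure (add_consts L C) M
    (fun n (f : fsym (add_consts L C) n) =>
       match f with
       | inl f => fint M f
       | inr c => let: Const a := c in fun _ => e a
       end)
    (fun n (r : rsym (add_consts L C) n) => rint M r).

(* Definable with parameters. *)
Definition definable (L : language) (M : structure L) (n : nat)
    (D : ('I_n -> M) -> Prop) : Prop :=
  exists phi : formula (add_consts L M) 'I_n,
    forall x : 'I_n -> M, D x <-> @sat _ (with_consts (fun a : M => a)) _ x phi.

Definition isolates (L : language) (K : structure L) (n : nat)
    (phi : formula L 'I_n) (b : 'I_n -> K) : Prop :=
  sat b phi /\
  forall psi : formula L 'I_n, sat b psi ->
    forall x : 'I_n -> K, sat x phi -> sat x psi.

Definition atomic (L : language) (K : structure L) : Prop :=
  forall n (b : 'I_n -> K), exists phi : formula L 'I_n, isolates phi b.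

(* The language of K names the elements of A, so its parameter-free types are
   the types over A. *)
Definition has_atomic_models_over_sets (L : language) (T : theory L) : Prop :=
  forall M : structure L, models M T ->
  forall A : M -> Prop,
  exists K : structure (add_consts L {a : M | A a}),
    models K (Th (with_consts (fun a : {a : M | A a} => sval a))) /\ atomic K.

Record sublanguage (L L' : language) := Sublanguage {
  fincl : forall n, fsym L n -> fsym L' n;
  rincl : forall n, rsym L n -> rsym L' n;
  fincl_inj : forall n, injective (@fincl n);
  rincl_inj : forall n, injective (@rincl n)
}.

Definition reduct (L L' : language) (i : sublanguage L L')
    (M : structure L') : structure L :=
  @Structure L M
    (fun n (f : fsym L n) => fint M (fincl i f))
    (fun n (r : rsym L n) => rint M (rincl i r)).

(* The symbols of the language of ordered groups with a constant 1. *)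
Record og_symbols (L : language) := OgSymbols {
  og_add : fsym L 2;
  og_opp : fsym L 1;
  og_zero : fsym L 0;
  og_one : fsym L 0;
  og_lt : rsym L 2
}.

(* A structure in a language extending that of ordered groups. *)
Record og_structure := OgStructure {
  lang : language;
  ogs : og_symbols lang;
  str :> structure lang
}.

Section OrderedGroups.
Variable M : og_structure.

Definition add (x y : M) : M := fint M (og_add (ogs M)) (tnth [tuple x; y]).
Definition opp (x : M) : M := fint M (og_opp (ogs M)) (tnth [tuple x]).
Definition zero : M := fint M (og_zero (ogs M)) (tnth [tuple]).
Definition one : M := fint M (og_one (ogs M)) (tnth [tuple]).
Definition lt (x y : M) : Prop := rint M (og_lt (ogs M)) (tnth [tuple x; y]).

Definition linear_order : Prop :=
  [/\ forall x, ~ lt x x,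
      forall x y z, lt x y -> lt y z -> lt x z &
      forall x y, lt x y \/ x = y \/ lt y x].

Definition group : Prop :=
  [/\ forall x y z, add x (add y z) = add (add x y) z,
      forall x, add zero x = x,
      forall x, add x zero = x,
      forall x, add (opp x) x = zero &
      forall x, add x (opp x) = zero].

Definition ordered_group : Prop :=
  [/\ linear_order,
      group,
      forall x y z, lt x y -> lt (add z x) (add z y),
      forall x y z, lt x y -> lt (add x z) (add y z) &
      lt zero one].

(* Membership in the open interval with endpoints I.1 and I.2, where an
   endpoint [None] is infinite. *)
Definition in_interval (I : option M * option M) (x : M) : Prop :=
  oapp (fun a => lt a x) True I.1 /\ oapp (fun b => lt x b) True I.2.

(* Density of the order is not required separately: an o-minimal ordered group
   with 0 < 1 is divisible, hence densely ordered. *)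
Definition o_minimal : Prop :=
  linear_order /\
  forall X : M -> Prop,
    definable (fun x : 'I_1 -> M => X (x ord0)) ->
    exists (points : seq M) (intervals : seq (option M * option M)),
      forall x, X x <->
        List.In x points \/ exists2 I, List.In I intervals & in_interval I x.

End OrderedGroups.

Definition og_symbols_incl (L L' : language) (i : sublanguage L L')
    (g : og_symbols L) : og_symbols L' :=
  OgSymbols (fincl i (og_add g)) (fincl i (og_opp g)) (fincl i (og_zero g))
    (fincl i (og_one g)) (rincl i (og_lt g)).

Definition ordered_group_reduct (M M' : og_structure) : Prop :=
  exists i : sublanguage (lang M) (lang M'),
    og_symbols_incl i (ogs M) = ogs M' /\ str M = reduct i M'.

Section Trace.
Variables (N : og_structure) (M : structure (lang N)) (j : M -> N).

(* The language of N with a new n-ary relation symbol for each definable subset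
   of N^n. *)
Definition trace_lang : language :=
  Language (fsym (lang N))
    (fun n => (rsym (lang N) n + {D : ('I_n -> N) -> Prop | definable D})%type).

(* M expanded by the traces on M^n of the definable D, with M regarded as a
   subset of N along j. *)
Definition trace : og_structure :=
  @OgStructure trace_lang
    (@OgSymbols trace_lang (og_add (ogs N)) (og_opp (ogs N)) (og_zero (ogs N))
       (og_one (ogs N)) (inl (og_lt (ogs N))))
    (@Structure trace_lang M
       (fun n (f : fsym trace_lang n) => fint M f)
       (fun n (r : rsym trace_lang n) =>
          match r with
          | inl r => rint M r
          | inr D => fun x => sval D (j \o x)
          end)).

End Trace.

(* The elementary substructure M of N is given by an elementary embedding j. *)
Definition o_minimal_trace (T : og_structure) : Prop :=
  exists (N : og_structure) (M : structure (lang N)) (j : M -> N),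
    [/\ ordered_group N /\ o_minimal N,
        elementary_embedding j,
        exists y : N, forall x : M, j x <> y,
        forall a b : N, lt a b -> exists x : M, lt a (j x) /\ lt (j x) b &
        T = trace j].

(* Main.v *)
(* Elements of M that lie in N-definable finite sets are governed by M-definable
   finite sets (base_cover: a parameter c outside M can be removed, since for
   points of M the defining condition holds either on a whole interval of values
   of c or for only finitely many of them). Hence every set definable in the
   trace is the trace of an N-definable set (trace_definable). So if M is not
   o-minimal, it defines a cut {x | x < r} with r in N but not in M.

   Choose positive eps_0, eps_1, ... in an ultrapower of M, each infinitesimal
   over M and the previous ones, and let A consist of M and the eps_n. If Th(M)
   had atomic models over sets, then some formula Q over A would isolate a
   complete type containing r - eps_0 < x < r. If Q has two solutions, then some
   eps_n is smaller than their distance, so by completeness every solution x has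
   another solution beyond x + eps_n, and Q has no supremum. If Q has one
   solution, then it lies in a finite set defined by an M-definable family at
   (eps_0, ..., eps_n); letting eps_n, ..., eps_0 tend to 0 in turn one gets
   finite M-definable sets, which consist of points of M and so stay away
   from r. *)

From Stdlib Require List.
From mathcomp Require Import all_boot.
From mathcomp Require Import boolp classical_sets filter.
Require Import Defs.

Set Implicit Arguments.
Unset Strict Implicit.
Unset Printing Implicit Defensive.

(** * Translations of formulas *)

Section Translation.
Variables (L L' : language) (C : Type).
Variable fm : forall n, fsym L n -> (fsym L' n + C)%type.
Variable rm : forall n, rsym L n -> rsym L' n.

(** One translation serves for substitution, for change of language and for trading constants
    against variables: a symbol that [fm] sends to [C] is replaced, together with its arguments, by
    the term that [k] provides. *)
Fixpoint ttr (V V' : Type) (s : V -> term L' V') (k : C -> term L' V')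
    (t : term L V) : term L' V' :=
  match t with
  | Var x => s x
  | App n f ts =>
      match fm f with
      | inl f' => App f' (fun i => ttr s k (ts i))
      | inr c => k c
      end
  end.

End Translation.

Definition no_const (L : language) n (f : fsym L n) : (fsym L n + void)%type :=
  inl f.
Definition tsubst (L : language) V V' (s : V -> term L V') (t : term L V) :=
  ttr (@no_const L) s (of_void _) t.

Definition wk (L : language) (X V : Type) (s : X -> term L V) (x : X) :
  term L (option V) := tsubst (fun y => Var L (Some y)) (s x).

Definition lift (L : language) (X V : Type) (s : X -> term L V) :
  option X -> term L (option V) := oapp (wk s) (Var L None).

Section FormulaTranslation.
Variables (L L' : language) (C : Type).
Variable fm : forall n, fsym L n -> (fsym L' n + C)%type.
Variable rm : forall n, rsym L n -> rsym L' n.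

Fixpoint ftr (V V' : Type) (s : V -> term L' V') (k : C -> term L' V')
    (phi : formula L V) : formula L' V' :=
  match phi with
  | Bot => Bot _ _
  | Eq a b => Eq (ttr fm s k a) (ttr fm s k b)
  | Rel n r ts => Rel (rm r) (fun i => ttr fm s k (ts i))
  | Imp p q => Imp (ftr s k p) (ftr s k q)
  | All p => All (ftr (lift s) (wk k) p)
  end.
End FormulaTranslation.

Lemma eval_ttr (L L' : language) (C : Type)
    (fm : forall n, fsym L n -> (fsym L' n + C)%type)
    (S : structure L) (S' : structure L') (h : S -> S') V V'
    (s : V -> term L' V') (k : C -> term L' V') (v : V -> S) (v' : V' -> S') :
  (forall n (f : fsym L n) x, h (fint S f x) =
     match fm n f with
     | inl f' => fint S' f' (h \o x)
     | inr c => eval v' (k c)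
     end) ->
  (forall x, eval v' (s x) = h (v x)) ->
  forall t, eval v' (ttr fm s k t) = h (eval v t).
Proof.
move=> hf hs; elim=> [x|n f ts IH] /=; first exact: hs.
rewrite hf; case: (fm n f) => [f'|c] //=.
by congr (fint S' f' _); apply: funext => i; rewrite /= IH.
Qed.

Lemma eval_tsubst (L : language) (S : structure L) V V' (s : V -> term L V')
    (v : V' -> S) (t : term L V) :
  eval v (tsubst s t) = eval (fun x => eval v (s x)) t.
Proof. exact: (@eval_ttr L L void (@no_const L) S S id). Qed.

Lemma eval_wk (L : language) (S : structure L) X V (s : X -> term L V)
    (v : V -> S) (a : S) x :
  eval (oapp v a) (wk s x) = eval v (s x).
Proof. by rewrite /wk eval_tsubst. Qed.

(** Injectivity of [h] settles equations and surjectivity the quantifier. The values [kv] are fixed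
    beforehand because [k] is weakened under a quantifier while its values stay the same. *)
Lemma sat_ftr (L L' : language) (C : Type)
    (fm : forall n, fsym L n -> (fsym L' n + C)%type)
    (rm : forall n, rsym L n -> rsym L' n)
    (S : structure L) (S' : structure L') (h : S -> S') (kv : C -> S') :
  injective h -> (forall y, exists x, h x = y) ->
  (forall n (f : fsym L n) x, h (fint S f x) =
     match fm n f with
     | inl f' => fint S' f' (h \o x)
     | inr c => kv c
     end) ->
  (forall n (r : rsym L n) x, rint S r x <-> rint S' (rm n r) (h \o x)) ->
  forall V (phi : formula L V) V' (s : V -> term L' V') (k : C -> term L' V')
    (v : V -> S) (v' : V' -> S'),
  (forall c, eval v' (k c) = kv c) ->
  (forall x, eval v' (s x) = h (v x)) ->
  sat v phi <-> sat v' (ftr fm rm s k phi).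
Proof.
move=> hi hsurj hf hr V; elim=> {V} /=.
- by [].
- move=> V a b V' s k v v' hk hs.
  have hf' n (f : fsym L n) x : h (fint S f x) =
     match fm n f with
     | inl f' => fint S' f' (h \o x)
     | inr c => eval v' (k c)
     end by rewrite hf; case: (fm n f).
  rewrite !(eval_ttr hf' hs); split=> [->|/hi] //.
- move=> V n r ts V' s k v v' hk hs.
  have hf' n' (f : fsym L n') x : h (fint S f x) =
     match fm n' f with
     | inl f' => fint S' f' (h \o x)
     | inr c => eval v' (k c)
     end by rewrite hf; case: (fm n' f).
  rewrite hr.
  suff -> : (h \o (fun i => eval v (ts i))) =
            (fun i => eval v' (ttr fm s k (ts i))) by [].
  by apply: funext => i /=; rewrite (eval_ttr hf' hs).
- move=> V p IHp q IHq V' s k v v' hk hs.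
  by have := IHp V' s k v v' hk hs; have := IHq V' s k v v' hk hs; tauto.
- move=> V p IH V' s k v v' hk hs.
  have E a : sat (oapp v a) p <-> sat (oapp v' (h a)) (ftr fm rm (lift s) (wk k) p).
    apply: IH => [c|[x|]] //=; first by rewrite eval_wk.
    by rewrite eval_wk hs.
  split=> H a; last by apply/E.
  by have [b <-] := hsurj a; apply/E.
Qed.

Definition fsubst (L : language) V V' (s : V -> term L V') (phi : formula L V) :=
  ftr (@no_const L) (fun n r => r) s (of_void _) phi.

Lemma sat_fsubst (L : language) (S : structure L) V V' (s : V -> term L V')
    (v : V' -> S) (phi : formula L V) :
  sat v (fsubst s phi) <-> sat (fun x => eval v (s x)) phi.
Proof.
apply: iff_sym.
by apply: (@sat_ftr L L void _ _ S S id (of_void _)) => // y; exists y.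
Qed.

Definition const_fm (L : language) (C : Type) n (f : fsym (add_consts L C) n) :
    (fsym L n + C)%type :=
  match f with inl f => inl f | inr c => inr (let: Const a := c in a) end.

Definition unconst (L : language) (C V : Type) (phi : formula (add_consts L C) V) :
    formula L (V + C) :=
  ftr (@const_fm L C) (fun n r => r) (fun x => Var L (inl x)) (fun c =>
    Var L (inr c)) phi.

Definition ext (X V W : Type) (c : W -> X) (v : V -> X) (x : V + W) : X :=
  match x with inl x => v x | inr w => c w end.

Lemma sat_unconst (L : language) (S : structure L) C (e : C -> S) V (v : V -> S) phi :
  @sat _ (with_consts e) V v phi <-> sat (ext e v) (unconst phi).
Proof.
apply: (@sat_ftr (add_consts L C) L C _ _ (with_consts e) S id e) => //.
- by move=> y; exists y.
- move=> n [f|[c]] x //=.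
Qed.

Definition cst (L : language) (C V : Type) (c : C) : term (add_consts L C) V :=
  @App (add_consts L C) V 0 (inr (Const c)) (fun i =>
    Var _ (match i with Ordinal m hm => False_rect V (notF hm) end)).

Definition to_const (L : language) (V W C V' : Type)
    (s : V + W -> V' + C) (phi : formula L (V + W)) :
    formula (add_consts L C) V' :=
  @ftr L (add_consts L C) void (fun n f => inl (inl f)) (fun n r => r) _ _
     (fun x => match s x with inl x => Var _ x | inr c => cst L V' c end)
     (of_void _) phi.

Lemma sat_to_const (L : language) (S : structure L) V W C V' (e : C -> S)
    (s : V + W -> V' + C) (v : V' -> S) (phi : formula L (V + W)) :
  @sat _ (with_consts e) _ v (to_const s phi) <->
  sat (fun x => ext e v (s x)) phi.
Proof.
apply: iff_sym.
apply: (@sat_ftr L (add_consts L C) void _ _ S (with_consts e) id (of_void _)) => //.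
- by move=> y; exists y.
- by move=> x; case: (s x) => [y|c].
Qed.

Definition lmap (L L' : language) (i : sublanguage L L') V (phi : formula L V) :
    formula L' V :=
  ftr (fun n f => inl (fincl i f) : (_ + void)%type) (fun n r => rincl i r)
    (fun x => Var L' x) (of_void _) phi.

Lemma sat_lmap (L L' : language) (i : sublanguage L L') (S : structure L') V
    (v : V -> S) (phi : formula L V) :
  @sat _ (reduct i S) _ v phi <-> sat v (lmap i phi).
Proof.
apply: (@sat_ftr L L' void _ _ (reduct i S) S id (of_void _)) => //.
by move=> y; exists y.
Qed.

Fixpoint tvars (L : language) (V : Type) (t : term L V) : seq V :=
  match t with
  | Var x => [:: x]
  | App n f ts => flatten [seq tvars (ts i) | i <- enum 'I_n]
  end.

Fixpoint fvars (L : language) (V : Type) (phi : formula L V) : seq V :=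
  match phi with
  | Bot => [::]
  | Eq a b => tvars a ++ tvars b
  | Rel n r ts => flatten [seq tvars (ts i) | i <- enum 'I_n]
  | Imp p q => fvars p ++ fvars q
  | All p => pmap id (fvars p)
  end.

Lemma In_cat (X : Type) (s1 s2 : seq X) x :
  List.In x (s1 ++ s2) <-> List.In x s1 \/ List.In x s2.
Proof. by elim: s1 => [|y s1 IH] /=; tauto. Qed.

Lemma In_flatten_enum (X : Type) n (g : 'I_n -> seq X) i x :
  List.In x (g i) -> List.In x (flatten [seq g i | i <- enum 'I_n]).
Proof.
move=> hx; have : i \in enum 'I_n by rewrite mem_enum.
elim: (enum 'I_n) => //= k s IH; rewrite inE In_cat => /orP [/eqP <-|/IH]; auto.
Qed.

Lemma eval_tvars (L : language) (S : structure L) V (v v' : V -> S) (t : term L V) :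
  (forall x, List.In x (tvars t) -> v x = v' x) -> eval v t = eval v' t.
Proof.
elim: t => [x|n f ts IH] /= h; first by apply: h; left.
congr (fint S f _); apply: funext => i; apply: IH => x hx.
exact/h/(In_flatten_enum (i := i)).
Qed.

Lemma sat_fvars (L : language) (S : structure L) V (phi : formula L V) (v v' : V -> S) :
  (forall x, List.In x (fvars phi) -> v x = v' x) -> sat v phi <-> sat v' phi.
Proof.
elim: phi v v' => {V} /= [V|V a b|V n r ts|V p IHp q IHq|V p IH] v v' h //.
- by rewrite !(@eval_tvars _ _ _ v v') // => x hx; apply: h; rewrite In_cat; tauto.
- suff -> : (fun i => eval v (ts i)) = (fun i => eval v' (ts i)) by [].
  apply: funext => i; apply: eval_tvars => x hx.
  exact/h/(In_flatten_enum (i := i)).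
- have := IHp v v'; have := IHq v v'.
  have hp x : List.In x (fvars p) -> v x = v' x by move=> ?; apply: h;
    rewrite In_cat; tauto.
  have hq x : List.In x (fvars q) -> v x = v' x by move=> ?; apply: h;
    rewrite In_cat; tauto.
  by move=> /(_ hq) ? /(_ hp) ?; tauto.
- have E a : sat (oapp v a) p <-> sat (oapp v' a) p.
    apply: IH => -[x|] //= hx; apply: h.
    elim: (fvars p) hx => //= -[y|] s IHs /= [] //; auto.
    by case=> ->; left.
  by split=> H a; apply/E.
Qed.

Lemma In_nth_ex (X : Type) (x0 : X) s x : List.In x s ->
  exists2 i, i < size s & nth x0 s i = x.
Proof.
elim: s => //= y s IH [->|/IH [i hi <-]]; first by exists 0.
by exists i.+1.
Qed.

(** A formula has finitely many variables, so any variable type reduces to some ['I_n]: [s] numbers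
    the variables and [d] reads the numbers back. *)
Lemma elementary_sat (L : language) (M N : structure L) (j : M -> N) :
  elementary_embedding j -> forall V (phi : formula L V) (v : V -> M),
  sat v phi <-> sat (fun x => j (v x)) phi.
Proof.
move=> hj V phi v.
have red n (s : V -> 'I_n) (d : 'I_n -> V) :
    (forall x, List.In x (fvars phi) -> d (s x) = x) ->
    sat v phi <-> sat (fun x => j (v x)) phi.
  move=> hds.
  have E (K : structure L) (w : V -> K) :
      sat w phi <-> sat (w \o d) (fsubst (fun x => Var L (s x)) phi).
    by rewrite sat_fsubst; apply: sat_fvars => x /hds /= ->.
  by rewrite (E M) (E N) hj.
have [[x0]|hV] := pselect (inhabited V); last first.
  have s (x : V) : 'I_0 by case: hV; exists.
  have d (i : 'I_0) : V by case: i.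
  by apply: (red _ s d) => x; case: hV; exists.
(* The successor guarantees an index for variables that do not occur, even if the list is empty. *)
have /choice [f hf] : forall x, exists i : 'I_(size (fvars phi)).+1,
    List.In x (fvars phi) -> nth x0 (fvars phi) i = x.
  move=> x; have [/(In_nth_ex x0) [i hi <-]|hx] := pselect (List.In x (fvars phi)).
    by exists (inord i); rewrite inordK // ltnS ltnW.
  by exists ord0.
exact: (red _ f (fun i => nth x0 (fvars phi) i)).
Qed.

(** * Definable predicates *)

Section Definability.
Variables (L : language) (S : structure L) (W : Type) (c : W -> S).

(* Formulas are handled through the predicates on valuations that they define
   with parameters in the image of c; Df2 and Df3 single out one or two more
   variables. *)
Definition Tm (V : Type) (t : (V -> S) -> S) : Prop :=
  exists a : term L (V + W), forall v, t v = eval (ext c v) a.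

Definition Df (V : Type) (P : (V -> S) -> Prop) : Prop :=
  exists phi : formula L (V + W), forall v, P v <-> sat (ext c v) phi.

Definition Df2 (V : Type) (E : (V -> S) -> S -> Prop) : Prop :=
  Df (fun v : option V -> S => E (fun x => v (Some x)) (v None)).

Lemma Tm_var V (x : V) : Tm (fun v => v x).
Proof. by exists (Var L (inl x)). Qed.

Lemma Tm_par V (w : W) : Tm (fun _ : V -> S => c w).
Proof. by exists (Var L (inr w)). Qed.

Lemma Tm_app V n (f : fsym L n) (t : 'I_n -> (V -> S) -> S) :
  (forall i, Tm (t i)) -> Tm (fun v => fint S f (fun i => t i v)).
Proof.
move=> /choice [a ha]; exists (App f a) => v /=.
by congr (fint S f _); apply: funext => i; rewrite ha.
Qed.

Lemma Df_ext V (P Q : (V -> S) -> Prop) : (forall v, P v <-> Q v) -> Df P -> Df Q.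
Proof. by move=> PQ [phi h]; exists phi => v; rewrite -PQ h. Qed.

Lemma Df_subst V V' (P : (V -> S) -> Prop) (t : V -> (V' -> S) -> S) :
  Df P -> (forall x, Tm (t x)) -> Df (fun v => P (fun x => t x v)).
Proof.
move=> [phi h] /choice [a ha].
exists (fsubst (fun x => match x with inl x => a x | inr w => Var L (inr w) end) phi).
move=> v; rewrite h sat_fsubst.
suff -> : ext c (t^~ v) = (fun x => eval (ext c v)
    match x with inl x0 => a x0 | inr w => Var L (inr w) end) by [].
by apply: funext => -[x|w] //=.
Qed.

Lemma Df2_app V V' (E : (V -> S) -> S -> Prop) (t : V -> (V' -> S) -> S) t0 :
  Df2 E -> (forall x, Tm (t x)) -> Tm t0 -> Df (fun v => E (fun x => t x v) (t0 v)).
Proof.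
move=> hE ht ht0.
by apply: (Df_subst (t := fun x => if x is Some x then t x else t0) hE) => -[x|].
Qed.

Lemma Df_rel V n (r : rsym L n) (t : 'I_n -> (V -> S) -> S) :
  (forall i, Tm (t i)) -> Df (fun v => rint S r (fun i => t i v)).
Proof.
move=> /choice [a ha]; exists (Rel r a) => v /=.
suff -> : (fun i => t i v) = (fun i => eval (ext c v) (a i)) by [].
by apply: funext => i; rewrite ha.
Qed.

Lemma Df_eq V (s t : (V -> S) -> S) : Tm s -> Tm t -> Df (fun v => s v = t v).
Proof. by move=> [a ha] [b hb]; exists (Eq a b) => v /=; rewrite ha hb. Qed.

Lemma Df_imp V (P Q : (V -> S) -> Prop) : Df P -> Df Q -> Df (fun v => P v -> Q v).
Proof. by move=> [p hp] [q hq]; exists (Imp p q) => v /=; rewrite hp hq. Qed.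

Lemma Df_cst V (P : Prop) : Df (fun _ : V -> S => P).
Proof.
have [hP|hP] := pselect P; last by exists (Bot _ _) => v /=; tauto.
by exists (Imp (Bot _ _) (Bot _ _)) => v /=; tauto.
Qed.

Lemma Df_not V (P : (V -> S) -> Prop) : Df P -> Df (fun v => ~ P v).
Proof. by move=> h; apply: Df_imp => //; exact: Df_cst. Qed.

Lemma Df_or V (P Q : (V -> S) -> Prop) : Df P -> Df Q -> Df (fun v => P v \/ Q v).
Proof.
move=> hp hq; apply: (Df_ext (P := fun v => ~ P v -> Q v)).
  by move=> v; have := lem (P v); tauto.
by apply: Df_imp => //; exact: Df_not.
Qed.

Lemma Df_and V (P Q : (V -> S) -> Prop) : Df P -> Df Q -> Df (fun v => P v /\ Q v).
Proof.
move=> hp hq; apply: (Df_ext (P := fun v => ~ (P v -> ~ Q v))).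
  by move=> v; have := lem (P v); have := lem (Q v); tauto.
by apply/Df_not/Df_imp => //; exact: Df_not.
Qed.

Lemma Df_all V (E : (V -> S) -> S -> Prop) : Df2 E -> Df (fun v => forall y, E v y).
Proof.
move=> [phi h].
exists (All (fsubst (fun x : option V + W => Var L
    match x with inl (Some x) => Some (inl x) | inl None => None | inr w =>
      Some (inr w) end) phi)).
move=> v /=.
suff E0 a : E v a <-> sat (oapp (ext c v) a) (fsubst (fun x : option V + W => Var L
    match x with inl (Some x) => Some (inl x) | inl None => None | inr w =>
      Some (inr w) end) phi).
  by split=> H a; apply/E0.
apply: iff_trans (h (oapp v a)) _; rewrite sat_fsubst.
by apply: sat_fvars => -[[x|]|w] _.
Qed.

Lemma Df_ex V (E : (V -> S) -> S -> Prop) : Df2 E -> Df (fun v => exists y, E v y).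
Proof.
move=> hE; apply: (Df_ext (P := fun v => ~ forall y, ~ E v y)).
  by move=> v; split=> [/existsNP [y /contrapT]|[y hy] /(_ y)]; first by exists y.
by apply/Df_not/Df_all/Df_not.
Qed.

End Definability.

Lemma Df_reparam (L : language) (S : structure L) W W' (c : W -> S) (c' : W' -> S) V
    (P : (V -> S) -> Prop) :
  (forall w, exists w', c' w' = c w) -> Df c P -> Df c' P.
Proof.
move=> /choice [f hf] [phi h].
exists (fsubst (fun x => Var L match x with inl x => inl x | inr w =>
  inr (f w) end) phi) => v.
rewrite h sat_fsubst; apply: sat_fvars => -[x|w] _ //=.
Qed.

Section OrderDefinability.
Variables (N : og_structure) (W : Type) (c : W -> N).

Lemma Tm_add V (s t : (V -> N) -> N) :
  Tm c s -> Tm c t -> Tm c (fun v => add (s v) (t v)).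
Proof.
move=> hs ht; have := @Tm_app _ N _ c V 2 (og_add (ogs N)) (tnth [tuple s; t]).
case=> [[[|[|i]] hi] //|a ha]; exists a => v; rewrite -ha /add.
by congr (fint _ _ _); apply: funext => -[[|[|i]] hi].
Qed.

Lemma Df_lt V (s t : (V -> N) -> N) :
  Tm c s -> Tm c t -> Df c (fun v => lt (s v) (t v)).
Proof.
move=> hs ht; have := @Df_rel _ N _ c V 2 (og_lt (ogs N)) (tnth [tuple s; t]).
case=> [[[|[|i]] hi] //|a ha]; exists a => v; rewrite -ha /lt.
suff -> : (fun i => tnth [tuple s; t] i v) = tnth [tuple s v; t v] by [].
by apply: funext => -[[|[|i]] hi].
Qed.

Lemma Tm_zero V : Tm c (fun _ : V -> N => zero N).
Proof.
have [[]//|a ha] := @Tm_app _ N _ c V 0 (og_zero (ogs N)) (tnth [tuple]).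
by exists a => v; rewrite -ha /zero; congr (fint _ _ _); apply: funext => -[].
Qed.

Lemma Tm_eqpar V (a : N) : (exists w, c w = a) -> Tm c (fun _ : V -> N => a).
Proof. by case=> w <-; exact: Tm_par. Qed.

End OrderDefinability.

Definition Df3 (L : language) (S : structure L) (W : Type) (c : W -> S) (V : Type)
    (F : (V -> S) -> S -> S -> Prop) : Prop :=
  Df c (fun v : option (option V) -> S => F (fun x =>
    v (Some (Some x))) (v (Some None)) (v None)).

Lemma Df3_app (L : language) (S : structure L) (W : Type) (c : W -> S) (V V' : Type)
    (F : (V -> S) -> S -> S -> Prop) (t : V -> (V' -> S) -> S) t1 t2 :
  Df3 c F -> (forall x, Tm c (t x)) -> Tm c t1 -> Tm c t2 ->
  Df c (fun v => F (fun x => t x v) (t1 v) (t2 v)).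
Proof.
move=> hF ht h1 h2.
by apply: (Df_subst (t := fun x => match x with
   Some (Some x) => t x | Some None => t1 | None => t2 end) hF) => -[[x|]|].
Qed.

Section UnaryBinary.
Variables (N : og_structure).
Implicit Types (D : N -> Prop) (G : N -> N -> Prop).

Definition Df1 D := Df (fun a : N => a) (fun v : unit -> N => D (v tt)).
Definition DfB (G : N -> N -> Prop) :=
  Df (fun a : N => a) (fun v : bool -> N => G (v true) (v false)).

Lemma Df1_app V D (t : (V -> N) -> N) : Df1 D -> Tm (fun a : N => a) t ->
  Df (fun a : N => a) (fun v => D (t v)).
Proof. by move=> hD ht; apply: (Df_subst (t := fun _ => t) hD). Qed.

Lemma DfB_app V G (s t : (V -> N) -> N) : DfB G -> Tm (fun a : N => a) s ->
  Tm (fun a : N => a) t -> Df (fun a : N => a) (fun v => G (s v) (t v)).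
Proof. by move=> hD hs ht; apply: (Df_subst (t := fun b : bool =>
  if b then s else t) hD) => -[]. Qed.

End UnaryBinary.

Ltac tm := solve [repeat match goal with
  | |- forall _, _ => intro
  | |- Tm _ (fun _ => zero _) => apply: Tm_zero
  | |- Tm _ (fun _ => ?a) => apply: Tm_eqpar; eauto
  | |- Tm _ (fun v => v _) => apply: Tm_var
  | |- Tm _ (fun v => add _ _) => apply: Tm_add
  | |- Tm _ _ => by eauto
  end].

Ltac df := rewrite /Df2 /=; repeat first
  [ exact: Df_cst
  | apply: Df_not | apply: Df_and | apply: Df_or
  | apply: Df_lt; tm
  | apply: Df_eq; tm
  | match goal with
    | |- Df _ (fun v => forall y : _ -> _, _) => fail 1
    | |- Df _ (fun v => exists y, _) => apply: Df_ex; rewrite /Df2 /=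
    | |- Df ?c (fun v => forall y : _, @?P v y) =>
        first [apply: Df_imp | apply: (@Df_all _ _ _ c); rewrite /Df2 /=]
    | H : Df2 _ ?E |- Df _ (fun v => ?E _ _) => apply: (Df2_app H); tm
    | H : Df3 _ ?F |- Df _ (fun v => ?F _ _ _) => apply: (Df3_app H); tm
    | H : Df1 ?D |- Df _ (fun v => ?D _) => apply: (Df1_app H); tm
    | H : DfB ?G |- Df _ (fun v => ?G _ _) => apply: (DfB_app H); tm
    end ].

(** * O-minimal ordered groups *)

Section LinearOrder.
Variables (N : og_structure) (hlin : linear_order N).
Implicit Types (a b p q x y : N).

Lemma ltxx x : ~ lt x x. Proof. by case: hlin => h _ _; exact: h. Qed.
Lemma lt_tr x y z : lt x y -> lt y z -> lt x z.
Proof. by case: hlin => _ h _; exact: h. Qed.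
Lemma lt_trich x y : lt x y \/ x = y \/ lt y x.
Proof. by case: hlin => _ _ h; exact: h. Qed.
Lemma nltP x y : ~ lt x y -> lt y x \/ x = y.
Proof. by have := lt_trich x y; tauto. Qed.

Lemma lt_neq x y : lt x y -> x <> y.
Proof. by move=> xy e; apply: (@ltxx x); rewrite {2}e. Qed.

End LinearOrder.

Ltac ord_sat H := repeat match goal with
  | h1 : lt ?a ?b, h2 : lt ?b ?c |- _ =>
      lazymatch goal with
      | _ : lt a c |- _ => fail
      | _ => have := lt_tr H h1 h2 => ?
      end
  end; match goal with h : lt ?a ?a |- _ => by case: (ltxx H h) end.

(* Decides the goal from the order hypotheses in the context; H : linear_order. *)
Ltac ord H :=
  repeat match goal with
  | h : _ /\ _ |- _ => case: h => ? ?
  | |- ~ _ => intro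
  | |- _ -> _ => intro
  end;
  match goal with
  | |- False => idtac
  | |- lt ?a ?b => case: (lt_trich H a b) => [//|[?|?]]; exfalso
  | |- @eq (carrier _) ?a ?b => case: (lt_trich H a b) => [?|[//|?]]; exfalso
  | |- _ => exfalso
  end;
  repeat match goal with
  | h : ~ lt ?a ?b, h' : lt ?a ?b |- _ => by case: (h h')
  | h : ~ lt ?a ?b |- _ => case: (nltP H h) => ?; clear h
  end;
  repeat match goal with
  | h : ?a = ?a |- _ => clear h
  | h : ?a = ?b, h' : lt ?a ?b |- _ => by case: (lt_neq H h' h)
  | h : ?a = ?b, h' : lt ?b ?a |- _ => by case: (lt_neq H h' (esym h))
  | h : ?a = ?b |- _ => first [subst a | subst b]
  | h : @eq (carrier _) ?a ?b |- _ =>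
      let x := fresh in let E := fresh in remember a as x eqn:E; clear E; subst x
  end;
  ord_sat H.

Section BreakPoints.
Variables (N : og_structure) (hlin : linear_order N).
Implicit Types (D X : N -> Prop) (B : seq N).

(** The form in which o-minimality is used: membership in [D] can change only at the finitely many
    points of [B]. *)
Definition breaks B D : Prop :=
  forall x y, lt x y -> (forall b, List.In b B -> lt b x \/ lt y b) -> (D x <-> D y).

Lemma breaks_exist D : o_minimal N -> Df1 D -> exists B, breaks B D.
Proof.
move=> [_ hm] [phi hphi].
have [|pts [ivs hD]] := hm D.
  exists (to_const (fun x => match x with inl _ => inl ord0 | inr a =>
    inr a end) phi) => x.
  rewrite (hphi (fun _ => x ord0)) sat_to_const.
  by apply: sat_fvars => -[[]|a].
(* The isolated points together with the finite endpoints of the intervals. *)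
exists (pts ++ flatten [seq pmap id [:: J.1; J.2] | J <- ivs]) => x y xy hB.
rewrite !hD.
have -> : List.In x pts <-> List.In y pts.
  split=> h; have := hB _ ((In_cat _ _ _).2 (or_introl h)); first by case=> ?; ord hlin.
  by case=> ?; ord hlin.
suff -> : (exists2 J, List.In J ivs & in_interval J x) <->
          (exists2 J, List.In J ivs & in_interval J y) by [].
have {}hB b : List.In b (flatten [seq pmap id [:: J.1;
  J.2] | J <- ivs]) -> lt b x \/ lt y b.
  by move=> h; apply: hB; rewrite In_cat; right.
suff E K : List.In K ivs -> in_interval K x <-> in_interval K y.
  by split=> -[J hJ hx]; exists J => //; apply/(E J hJ).
elim: ivs hB {hD} => //= J ivs IH hB [<-|]; last first.
  by apply: IH => b hb; apply: hB; rewrite In_cat; right.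
have {IH}hB b : List.In b (pmap id [:: J.1; J.2]) -> lt b x \/ lt y b.
  by move=> h; apply: hB; rewrite In_cat; left.
rewrite /in_interval; case: J hB => -[u|] [w|] /= hB;
  try (have hu : lt u x \/ lt y u by apply: hB; auto);
  try (have hw : lt w x \/ lt y w by apply: hB; auto);
  clear hB; try (case: hu => hu); try (case: hw => hw);
  split=> -[h1 h2]; split=> //; ord hlin.
Qed.

End BreakPoints.

Section Groups.
Variables (N : og_structure) (hO : ordered_group N).
Implicit Types (x y z : N).

Lemma addA x y z : add x (add y z) = add (add x y) z.
Proof. by case: hO => _ [h _ _ _ _]. Qed.
Lemma add0 x : add (zero N) x = x. Proof. by case: hO => _ [_ h _ _ _]. Qed.
Lemma addx0 x : add x (zero N) = x. Proof. by case: hO => _ [_ _ h _ _]. Qed.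
Lemma addN x : add (opp x) x = zero N. Proof. by case: hO => _ [_ _ _ h _]. Qed.
Lemma addxN x : add x (opp x) = zero N. Proof. by case: hO => _ [_ _ _ _ h]. Qed.
Lemma add_ltl z x y : lt x y -> lt (add z x) (add z y).
Proof. by case: hO => _ _ h _ _; exact: h. Qed.
Lemma add_ltr z x y : lt x y -> lt (add x z) (add y z).
Proof. by case: hO => _ _ _ h _; exact: h. Qed.
Lemma addNK x y : add x (add (opp x) y) = y.
Proof. by rewrite addA addxN add0. Qed.
Lemma addKN x y : add (add x (opp y)) y = x.
Proof. by rewrite -addA addN addx0. Qed.
Lemma addKNr x y : add (add x y) (opp y) = x.
Proof. by rewrite -addA addxN addx0. Qed.
Lemma add_ltxD x e : lt (zero N) e -> lt x (add x e).
Proof. by move=> he; rewrite -{1}[x]addx0; exact: add_ltl. Qed.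
Lemma lt_above x : exists y, lt x y.
Proof. by exists (add x (one N)); apply: add_ltxD; case: hO. Qed.
Lemma lt_below x : exists y, lt y x.
Proof.
exists (add x (opp (one N))); rewrite -{2}[x](addKN _ (one N)).
by apply: add_ltxD; case: hO.
Qed.

End Groups.

(** * Sets in one variable: germs, cuts and small sets *)

Section OMinimal.
Variables (N : og_structure) (hO : ordered_group N) (hm : o_minimal N).
Hypothesis hd : forall a b : N, lt a b -> exists x, lt a x /\ lt x b.
Implicit Types (D X Y : N -> Prop) (B : seq N) (a b p q x y z t : N).

Let hl : linear_order N := hm.1.

(** Each point of [B] inside the current interval becomes its new right end. Here and below
    [~ lt u w] stands for [w <= u]. *)
Lemma avoid_right B a u : lt a u -> exists w, [/\ lt a w, ~ lt u w &
  forall b, List.In b B -> ~ (lt a b /\ lt b w)].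
Proof.
move=> au; elim: B => [|b B [w [aw wu hw]]].
  by exists u; split=> //; exact: ltxx.
have [[ab bw]|nb] := lem (lt a b /\ lt b w).
  exists b; split=> //; first by ord hl.
  by move=> c /= [->|/hw hc]; [ord hl | move=> ?; apply: hc; split; ord hl].
by exists w; split=> // c /= [<-|/hw].
Qed.

Lemma avoid_left B a u : lt u a -> exists w, [/\ lt w a, ~ lt w u &
  forall b, List.In b B -> ~ (lt w b /\ lt b a)].
Proof.
move=> au; elim: B => [|b B [w [aw wu hw]]].
  by exists u; split=> //; exact: ltxx.
have [[ab bw]|nb] := lem (lt w b /\ lt b a).
  exists b; split=> //; first by ord hl.
  by move=> c /= [->|/hw hc]; [ord hl | move=> ?; apply: hc; split; ord hl].
by exists w; split=> // c /= [<-|/hw].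
Qed.

Definition near_right a (P : N -> Prop) := exists w, lt a w /\ forall x, lt a x ->
  lt x w -> P x.

Lemma near_right_bound a u P : lt a u -> near_right a P ->
  exists w, [/\ lt a w, ~ lt u w & forall x, lt a x -> lt x w -> P x].
Proof.
move=> au [w [aw h]]; have [uw|uw] := lem (lt u w); last by exists w.
by exists u; split=> //; [ord hl | move=> x ax xu; apply: h => //; ord hl].
Qed.

Lemma near_right_and a P Q : near_right a P -> near_right a Q ->
  near_right a (fun x => P x /\ Q x).
Proof.
move=> [w [aw hP]] /(near_right_bound aw) [u [au wu hQ]].
exists u; split=> // x ax xu; split; last exact: hQ.
by apply: hP => //; ord hl.
Qed.

Lemma near_right_imp a P Q : (forall x, lt a x -> P x -> Q x) -> near_right a P ->
  near_right a Q.
Proof. by move=> h [w [aw hP]]; exists w; split=> // x ax xw; apply: h => //;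
  exact: hP. Qed.

Lemma near_right_ex a P : near_right a P -> exists x, lt a x /\ P x.
Proof. by move=> [w [/hd [x [ax xw]] h]]; exists x; split=> //; exact: h. Qed.

Lemma near_right_lt a u : lt a u -> near_right a (fun x => lt x u).
Proof. by move=> au; exists u. Qed.

(** An interval to the right of [a] short enough to contain no break point has constant membership
    in [P]. *)
Lemma near_right_dec a P : Df1 P -> near_right a P \/ near_right a (fun x => ~ P x).
Proof.
move=> /(breaks_exist hl hm) [B hB]; have [u au] := lt_above hO a.
have [w [aw _ hw]] := avoid_right B au.
have hc x y : lt a x -> lt x y -> lt y w -> P x <-> P y.
  move=> ax xy yw; apply: hB => // b /hw hb.
  have [?|[?|?]] := lt_trich hl b x; [by left | by subst b; case: hb; split => //;
    ord hl|].
  right; have [//|hby] := lem (lt y b); case: hb; split; ord hl.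
have [x0 [ax0 x0w]] := hd aw.
have hc' x : lt a x -> lt x w -> P x <-> P x0.
  by move=> ax xw; have [?|[->|?]] := lt_trich hl x x0; [exact: hc| |apply: iff_sym;
    exact: hc].
by have [h|h] := lem (P x0); [left|right]; exists w; split=> // x ax xw; rewrite hc'.
Qed.

(** Induction on the break points, with [z] in [P] and [u] outside: a break point strictly between
    them replaces [z] or [u] according to whether it is in [P]. With none left, [P] is constant
    between [z] and [u], and the boundary is one of the two. *)
Lemma cut_exists P z u : Df1 P -> (forall x y, lt x y -> P y -> P x) -> P z -> ~ P u ->
  exists s, (forall y, lt y s -> P y) /\ (forall y, lt s y -> ~ P y).
Proof.
move=> /(breaks_exist hl hm) [B hB] dP.
have {hB} : forall x y, lt z x -> lt x y -> lt y u -> (forall b, List.In b B ->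
  lt b x \/ lt y b) ->
   (P x <-> P y) by move=> x y _ xy _; exact: hB.
elim: B z u => [|b B IH] z u hB Pz Pu.
  have [[x [zx [xu Px]]]|no] := lem (exists x, lt z x /\ lt x u /\ P x).
    exists u; split=> y hy; last by move/(dP _ _ hy).
    have [yx|[->|xy]] := lt_trich hl y x; [exact: dP Px| by []|].
    by apply/(hB x y).
  exists z; split=> y hy; first exact: dP Pz.
  have [yu Py|[->|uy]] := lt_trich hl y u; [by case: no; exists y| by []|].
  by move/(dP _ _ uy).
have [[zb bu]|nb] := lem (lt z b /\ lt b u); last first.
  apply: (IH z u) => // x y zx xy yu hb; apply: hB => // c /= [<-|/hb //].
  have [?|[?|?]] := lt_trich hl b x; [by left| |].
    by case: nb; split; ord hl.
  right; have [//|hby] := lem (lt y b); case: nb; split; ord hl.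
have [Pb|Pb] := lem (P b).
  apply: (IH b u) => // x y bx xy yu hb; apply: hB => // [|c /= [<-|/hb //]];
    last by left.
  by ord hl.
apply: (IH z b) => // x y zx xy yb hb; apply: hB => // [|c /= [<-|/hb //]];
  last by right.
by ord hl.
Qed.

(* For definable sets this means finite, by small_breaks. *)
Definition small X := ~ exists p q, lt p q /\ forall y, lt p y -> lt y q -> X y.

Lemma small_sub X Y : (forall x, X x -> Y x) -> small Y -> small X.
Proof. by move=> XY hY [p [q [pq h]]]; apply: hY; exists p, q; split=> // y ??;
  apply/XY/h. Qed.

Lemma small_ev X a : small X -> ~ near_right a X.
Proof. by move=> h [w [aw hw]]; apply: h; exists a, w. Qed.

Lemma small_evN X a : Df1 X -> small X -> near_right a (fun x => ~ X x).
Proof. by move=> /(near_right_dec a) [|//] h /small_ev; case/(_ a h). Qed.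

Lemma small_or X Y : Df1 X -> small X -> small Y -> small (fun x => X x \/ Y x).
Proof.
move=> dX sX sY [p [q [pq h]]].
apply: (small_ev (a := p) sY); apply: near_right_imp (near_right_and (small_evN p dX
  sX) (near_right_lt pq)).
by move=> x px [nX xq]; have := h x px xq; tauto.
Qed.

(** Off the break points membership is locally constant, so a point of [X] outside [B] would have a
    whole interval of [X] around it. *)
Lemma small_breaks X B : breaks B X -> small X -> forall y, X y -> List.In y B.
Proof.
move=> hB sX y Xy; apply: contrapT => yB; apply: sX.
have [u0 yu0] := lt_above hO y; have [w0 wy0] := lt_below hO y.
have [u [yu _ hu]] := avoid_right B yu0; have [w [wy _ hw]] := avoid_left B wy0.
exists w, u; split=> [|x wx xu]; first by ord hl.
have [xy|[->//|yx]] := lt_trich hl x y.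
  apply/(hB x y) => // b bB; have hb := hw b bB.
  have [?|[?|?]] := lt_trich hl b y; [|by subst b|by right].
  have [?|hbx] := lem (lt b x); [by left|case: hb; split; ord hl].
apply/(hB y x) => // b bB; have hb := hu b bB.
have [?|[?|?]] := lt_trich hl b y; [by left|by subst b|].
have [?|hbx] := lem (lt x b); [by right|case: hb; split; ord hl].
Qed.

Lemma list_min B X y0 : X y0 -> (forall y, X y -> lt y y0 -> List.In y B) ->
  exists m, X m /\ forall y, X y -> ~ lt y m.
Proof.
elim: B y0 => [|b B IH] y0 X0 h; first by exists y0.
have [[Xb b0]|nb] := lem (X b /\ lt b y0).
  apply: (IH b) => // y Xy yb; case: (h y Xy) => //; first by ord hl.
  by move=> ?; subst; case: (ltxx hl yb).
by apply: (IH y0) => // y Xy yy0; case: (h y Xy yy0) => // ?; subst; case: nb.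
Qed.

End OMinimal.

Ltac dfi := rewrite /near_right /small; df.

(** * Definable families of sets: exchange of fibres and limits *)

Section Planes.
Variables (N : og_structure) (hO : ordered_group N) (hm : o_minimal N).
Hypothesis hd : forall a b : N, lt a b -> exists x, lt a x /\ lt x b.
Implicit Types (D X Y : N -> Prop) (E G : N -> N -> Prop) (a b p q x y z t : N).

Let hl : linear_order N := hm.1.

(** A definable chain of sets covering [(a, b)] cannot consist of finite sets only. Otherwise the
    least elements of its members would come arbitrarily close to [a], so every point just right of
    [a] would be such a least element, and a member containing one of these points would contain all
    later ones. *)
Lemma chain_interval G a b : lt a b -> DfB G ->
  (forall y, lt a y -> lt y b -> exists t, G y t) ->
  (forall t t', (forall y, lt a y -> lt y b -> G y t -> G y t') \/
                (forall y, lt a y -> lt y b -> G y t' -> G y t)) ->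
  exists t a' b', lt a' b' /\ forall y, lt a' y -> lt y b' ->
    [/\ lt a y, lt y b & G y t].
Proof.
move=> ab dG cov chn; apply: contrapT => no.
pose S t y := [/\ lt a y, lt y b & G y t].
have sS t : small (S t).
  by move=> [p [q [pq h]]]; apply: no; exists t, p, q.
have dS t : Df1 (S t).
  apply: (Df_ext (P := fun v => lt a (v tt) /\ lt (v tt) b /\ G (v tt) t)).
    by move=> v; rewrite /S; split=> [[? []]|[]].
  by dfi.
(* The points that enter the chain before all points to their left. *)
pose P y := exists t, G y t /\ forall z, lt a z -> lt z y -> ~ G z t.
have dP : Df1 P by rewrite /Df1 /P; dfi.
have acc y0 : lt a y0 -> lt y0 b -> exists m, [/\ lt a m, ~ lt y0 m & P m].
  move=> ay0 y0b; have [t ht] := cov y0 ay0 y0b.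
  have [B hB] := breaks_exist hl hm (dS t).
  have [m [[am mb Gm] hmin]] := list_min hm (X := S t) (And3 ay0 y0b ht)
    (fun y Sy _ => small_breaks hO hm hB (@sS t) Sy).
  exists m; split=> //; first exact: hmin.
  by exists t; split=> // z az zm Gz; apply: (hmin z) => //; split=> //; ord hl.
have [evP|evP] := near_right_dec hO hm hd a dP; last first.
  have [w [aw wb hw]] := near_right_bound hm ab evP.
  have [y0 [ay0 y0w]] := hd aw.
  have [m [am my0 Pm]] : exists m, [/\ lt a m, ~ lt y0 m & P m] by apply: acc => //;
    ord hl.
  by apply: (hw m) => //; ord hl.
have [w [aw wb hw]] := near_right_bound hm ab evP.
have [y1 [ay1 y1w]] := hd aw.
have [t1 [G1 _]] := hw y1 ay1 y1w.
apply: (sS t1); exists y1, w; split=> // y y1y yw.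
have ay : lt a y by ord hl.
have yb : lt y b by ord hl.
have [t [Gt nt]] := hw y ay yw.
(* The member at [t] contains [y] but not [y1], so it cannot contain the member at [t1] and is
   contained in it. *)
split=> //; have [h|h] := chn t t1; first exact: h.
case: (nt y1) => //; apply: h => //; ord hl.
Qed.

(** By three uses of [chain_interval], over a smaller interval the fibres contain intervals that lie
    between fixed bounds [t2] and [t1] and have a common length [e]. As [y] decreases to the left
    end [a3], the infimum of their left ends tends to some [s], and a point [c] between [s] and
    [s + e] lies in [E y] for all [y] close to [a3]. *)
Lemma interval_exchange E a b : lt a b -> DfB E ->
  (forall y, lt a y -> lt y b -> ~ small (E y)) ->
  exists c, ~ small (fun y => [/\ lt a y, lt y b & E y c]).
Proof.
move=> ab dE hE.
have [t1 [a1 [b1 [ab1 h1]]]] : exists t a' b', lt a' b' /\ forall y, lt a' y ->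
  lt y b' ->
    [/\ lt a y, lt y b & ~ small (fun c => lt c t /\ E y c)].
  apply: (@chain_interval (fun y t => ~ small (fun c => lt c t /\ E y c))) => //.
  - by rewrite /DfB; dfi.
  - move=> y ay yb; have /contrapT [p [q [pq h]]] := hE y ay yb.
    by exists q => -[]; exists p, q; split=> // c pc cq; split=> //; exact: h.
  - move=> t t'; have [?|?] := lem (lt t t').
      left=> y ay yb h s; apply: h; apply: small_sub s => c [ct Ec]; split=> //; ord hl.
    right=> y ay yb h s; apply: h; apply: small_sub s => c [ct Ec]; split=> //; ord hl.
have [t2 [a2 [b2 [ab2 h2]]]] : exists t a' b', lt a' b' /\ forall y, lt a' y ->
  lt y b' ->
    [/\ lt a1 y, lt y b1 & ~ small (fun c => lt t c /\ lt c t1 /\ E y c)].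
  apply: (@chain_interval (fun y t => ~ small (fun c =>
    lt t c /\ lt c t1 /\ E y c))) => //.
  - by rewrite /DfB; dfi.
  - move=> y ay yb; have [_ _ /contrapT [p [q [pq h]]]] := h1 y ay yb.
    by exists p => -[]; exists p, q; split=> // c pc cq; split=> //; exact: h.
  - move=> t t'; have [?|?] := lem (lt t t').
      right=> y ay yb h s; apply: h; apply: small_sub s => c [ct Ec]; split=> //;
        ord hl.
    left=> y ay yb h s; apply: h; apply: small_sub s => c [ct Ec]; split=> //; ord hl.
have [e [a3 [b3 [ab3 h3]]]] : exists t a' b', lt a' b' /\ forall y, lt a' y ->
  lt y b' ->
    [/\ lt a2 y, lt y b2 & lt (zero N) t /\ exists p, ~ lt p t2 /\ ~ lt t1 (add p t) /\
      forall c, lt p c -> lt c (add p t) -> E y c].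
  apply: (@chain_interval (fun y t =>
    lt (zero N) t /\ exists p, ~ lt p t2 /\ ~ lt t1 (add p t) /\
      forall c, lt p c -> lt c (add p t) -> E y c)) => //.
  - by rewrite /DfB; dfi.
  - move=> y ay yb; have [_ _ /contrapT [p [q [pq h]]]] := h2 y ay yb.
    exists (add (opp p) q); split.
      by rewrite -(addN hO p); exact: add_ltl.
    exists p; rewrite (addNK hO); split; [|split].
    + move=> pt; have [u [pu [uq ut]]] : exists u, lt p u /\ lt u q /\ lt u t2.
        have [qt|qt] := lem (lt q t2).
          by have [u [pu uq]] := hd pq; exists u; do !split=> //; ord hl.
        by have [u [pu uq]] := hd pt; exists u; do !split=> //; ord hl.
      by have [? _] := h u pu uq; ord hl.
    + move=> tq; have [u [pu [uq ut]]] : exists u, lt p u /\ lt u q /\ lt t1 u.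
        have [qt|qt] := lem (lt t1 p).
          by have [u [pu uq]] := hd pq; exists u; do !split=> //; ord hl.
        by have [u [pu uq]] := hd tq; exists u; do !split=> //; ord hl.
      by have [_ [? _]] := h u pu uq; ord hl.
    + by move=> c pc cq; have [_ []] := h c pc cq.
  - have mono t t' y : lt (zero N) t -> lt t t' ->
      (lt (zero N) t' /\ exists p, ~ lt p t2 /\ ~ lt t1 (add p t') /\
        forall c, lt p c -> lt c (add p t') -> E y c) ->
      (lt (zero N) t /\ exists p, ~ lt p t2 /\ ~ lt t1 (add p t) /\
        forall c, lt p c -> lt c (add p t) -> E y c).
      move=> t0 tt' [_ [p [hp [hp' hc]]]]; split=> //; exists p;
        have := add_ltl hO p tt' => ?.
      by split=> //; split=> [|c pc cp]; [|apply: hc => //]; ord hl.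
    move=> t t'; have [t0|t0] := lem (lt (zero N) t); last by left=> y _ _ [].
    have [t0'|t0'] := lem (lt (zero N) t'); last by right=> y _ _ [].
    by have [?|[->|?]] := lt_trich hl t t'; [right|left|left] => // y _ _; exact: mono.
have e0 : lt (zero N) e.
  by have [y [ay yb]] := hd ab3; have [_ _ []] := h3 y ay yb.
(* [V z] says that close to [a3] some such interval starts below [z]; the boundary of [V] is the
   limit [s]. *)
pose V z := near_right a3 (fun y =>
  exists p, ~ lt p t2 /\ lt p z /\ forall c, lt p c -> lt c (add p e) -> E y c).
have dV z : Df1 (fun y => exists p, ~ lt p t2 /\ lt p z /\ forall c, lt p c ->
  lt c (add p e) -> E y c).
  by rewrite /Df1; dfi.
have [s [hs hs']] : exists s, (forall y, lt y s -> ~ V y) /\ (forall y, lt s y ->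
  ~ ~ V y).
  apply: (@cut_exists N hm (fun y => ~ V y) t2 t1).
  - by rewrite /Df1 /V; dfi.
  - move=> x y xy nV hV; apply: nV; apply: near_right_imp hV => w _ [p [hp [hp' hc]]].
    by exists p; do !split=> //; ord hl.
  - by move=> /(near_right_ex hd) [x [_ [p [hp [hp' _]]]]].
  - move=> hV; apply: hV; exists b3; split=> // y ay yb.
    have [_ _ [_ [p [hp [hp' hc]]]]] := h3 y ay yb; exists p; do !split=> //.
    by have := add_ltxD hO p e0 => ?; ord hl.
have [c [sc ce]] := hd (add_ltxD hO s e0).
have [q [sq qc]] := hd sc.
have cs : lt (add c (opp e)) s by rewrite -[X in lt _ X](addKNr hO _ e); exact: add_ltr.
have [p [cp ps]] := hd cs.
have /contrapT Vq := hs' q sq.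
have [Vp|nVp] := near_right_dec hO hm hd a3 (dV p); first by case: (hs p ps).
exists c => sc'.
apply: (small_ev (a := a3) sc').
apply: near_right_imp (near_right_and hm (near_right_and hm Vq nVp) (near_right_lt
  ab3)) => y ay [[[r [rt [rq hr]]] hn] yb].
have [a2y yb2 _] := h3 y ay yb; have [a1y yb1 _] := h2 y a2y yb2;
  have [? ? _] := h1 y a1y yb1.
split=> //; apply: (hr); first by ord hl.
(* The interval starts at [r] with [p <= r < q], and [c - e < p] and [q < c], so it contains [c]. *)
have hpr : ~ lt r p by move=> rp; apply: hn; exists r.
have : lt (add (add c (opp e)) e) (add r e) by apply: (add_ltr hO); ord hl.
by rewrite (addKN hO).
Qed.

(* The limit points of the sets E t as t tends to 0 from the right. *)
Definition limset E y := forall p q, lt p y -> lt y q ->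
  ~ near_right (zero N) (fun t => forall z, lt p z -> lt z q -> ~ E t z).

(** Suppose the limit set contains an interval. Near its left end either every [y] lies in [E t] for
    all small [t], or every [y] lies in [E t] for no small [t]. On a subinterval [chain_interval]
    makes the bound on [t] uniform in [y]; then some [E t] contains an interval, or the subinterval
    misses the limit set. *)
Lemma limset_small E : DfB E -> (forall t, small (E t)) -> small (limset E).
Proof.
move=> dE sE [a [b [ab hlim]]].
have dY : Df1 (fun y => near_right (zero N) (fun t => E t y)) by rewrite /Df1; dfi.
have key (F : N -> N -> Prop) : DfB F ->
    near_right a (fun y => near_right (zero N) (fun t => F t y)) ->
    exists a' b' t, [/\ lt a' b', lt (zero N) t & forall s y, lt (zero N) s -> lt s t ->
      lt a' y -> lt y b' -> [/\ lt a y, lt y b & F s y]].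
  move=> dF /(near_right_bound hm ab) [w [aw wb hw]].
  have [t [a' [b' [ab' h]]]] : exists t a' b', lt a' b' /\ forall y, lt a' y ->
    lt y b' ->
      [/\ lt a y, lt y w & lt (zero N) t /\ forall s, lt (zero N) s -> lt s t -> F s y].
    apply: (@chain_interval (fun y t =>
      lt (zero N) t /\ forall s, lt (zero N) s -> lt s t -> F s y)) => //.
    - by rewrite /DfB; dfi.
    - move=> t t'; have [t0|t0] := lem (lt (zero N) t); last by left=> y _ _ [].
      have [t0'|t0'] := lem (lt (zero N) t'); last by right=> y _ _ [].
      have [?|?] := lem (lt t t'); [right|left] => y _ _ [_ h]; split=> // s s0 st;
        apply: h => //; ord hl.
  have t0 : lt (zero N) t by have [y [ay yb]] := hd ab'; have [_ _ []] := h y ay yb.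
  exists a', b', t; split=> // s y s0 st ay yb; have [? ? [_ hF]] := h y ay yb.
  by split=> //; [ord hl | exact: hF].
have [h|h] := near_right_dec hO hm hd a dY.
  have [a' [b' [t [ab' t0 ht]]]] := key E dE h.
  have [s [s0 st]] := hd t0.
  by apply: (sE s); exists a', b'; split=> // y ay yb; have [] := ht s y s0 st ay yb.
have dNE : DfB (fun t y => ~ E t y) by rewrite /DfB; dfi.
have [|a' [b' [t [ab' t0 ht]]]] := key _ dNE.
- apply: near_right_imp h => y ay hy.
  have dEy : Df1 (fun t => E t y) by rewrite /Df1; dfi.
  by have [] := near_right_dec hO hm hd (zero N) dEy.
- have [y [ay yb]] := hd ab'; have [s [s0 st]] := hd t0.
  have [ay' yb' _] := ht s y s0 st ay yb.
  apply: (hlim y ay' yb' a' b') => //.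
  by exists t; split=> // r r0 rt z az zb; have [] := ht r z r0 rt az zb.
Qed.

(** [Z] is contained in its list of break points, so the union is a finite one. *)
Lemma small_bigU (Z : N -> Prop) E : Df1 Z -> DfB E -> small Z ->
  (forall z, small (E z)) ->
  small (fun y => exists z, Z z /\ E z y).
Proof.
move=> dZ dE sZ sE; have [B hB] := breaks_exist hl hm dZ.
apply: (@small_sub _ _ (fun y => exists z, List.In z B /\ E z y)) => [y [z [Zz Ez]]|].
  by exists z; split=> //; apply: (small_breaks hO hm hB sZ).
elim: B {hB} => [|b B IH].
  by move=> [p [q [pq h]]]; have [y [py yq]] := hd pq; have [z []] := h y py yq.
apply: (@small_sub _ _ (fun y => E b y \/ exists z, List.In z B /\ E z y)).
  by move=> y [z /= [[<-|hz] Ez]]; [left|right; exists z].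
apply: (small_or hO hm hd) => //; rewrite /Df1; dfi.
Qed.

(* Definable compactness of [p, r]. *)
Lemma limset_avoid E p r : DfB E ->
  (forall y, ~ lt y p -> ~ lt r y -> ~ limset E y) ->
  near_right (zero N) (fun t => forall y, ~ lt y p -> ~ lt r y -> ~ E t y).
Proof.
move=> dE hlim.
pose Z z := lt z p \/ near_right (zero N) (fun t =>
  forall y, ~ lt y p -> ~ lt z y -> ~ E t y).
have dZ : Df1 Z by rewrite /Df1 /Z; dfi.
have [[rp|//]|nZr] := lem (Z r).
  by exists (one N); split=> [|t _ _ y yp ry]; [case: hO | exfalso; ord hl].
have [p0 p0p] := lt_below hO p.
have [s [hs hs']] : exists s, (forall y, lt y s -> Z y) /\ (forall y, lt s y -> ~ Z y).
  apply: (cut_exists hm (z := p0) dZ _ _ nZr); last by left.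
  move=> x y xy [yp|h]; first by left; ord hl.
  by right; apply: near_right_imp h => t _ h w wp xw; apply: h => //; ord hl.
have sp : ~ lt s p by move=> /hd [y [sy yp]]; apply: (hs' y sy); left.
have sr : ~ lt r s by move/hs.
(* The supremum [s] of [Z] is not a limit point, so a neighbourhood of [s] is avoided for small [t],
   and this puts a point beyond [s] into [Z]. *)
have /existsNP [p' /existsNP [q' /not_implyP [ps /not_implyP [sq /contrapT hev]]]] :=
  hlim s sp sr.
have [y1 [py1 y1s]] := hd ps; have [y2 [sy2 y2q]] := hd sq.
case: (hs' y2 sy2); right.
have [y1p|h] := hs y1 y1s.
  apply: near_right_imp hev => t _ h y yp y2y; apply: h; ord hl.
apply: near_right_imp (near_right_and hm h hev) => t _ [h1 h2] y yp y2y.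
have [y1y|y1y] := lem (lt y1 y); last by apply: h1.
by apply: h2; ord hl.
Qed.

End Planes.

(** * Dense pairs and traces *)

Section DensePair.
Variables (N : og_structure) (hO : ordered_group N) (hm : o_minimal N).
Variables (M : structure (lang N)) (j : M -> N) (hj : elementary_embedding j).
Hypothesis hdj : forall a b : N, lt a b -> exists x : M, lt a (j x) /\ lt (j x) b.
Implicit Types (V : Type) (y z p q : N).

Let hl : linear_order N := hm.1.

Lemma dense_order (a b : N) : lt a b -> exists x, lt a x /\ lt x b.
Proof. by move=> /hdj [x hx]; exists (j x). Qed.
Let hd := dense_order.

Lemma tarski_vaught (Q : N -> Prop) :
  Df j (fun v : unit -> N => Q (v tt)) -> (exists y, Q y) -> exists m : M, Q (j m).
Proof.
move=> [phi hphi] [y Qy]; apply: contrapT => no.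
pose psi := fsubst (fun x => Var (lang N) match x with inl _ => None | inr m =>
  Some m end) phi.
have hpsi a : sat (oapp j a) psi <-> Q a.
  rewrite sat_fsubst (hphi (fun _ => a)).
  by apply: sat_fvars => -[[]|m].
have : sat (fun m => j m) (All (Imp psi (Bot _ _))).
  apply/(elementary_sat hj (All (Imp psi (Bot _ _))) id) => /= a /(elementary_sat hj).
  suff -> : (fun x => j (oapp id a x)) = oapp j (j a).
    by move/hpsi => Qa; apply: no; exists a.
  by apply: funext => -[].
by move=> /(_ y) /=; apply; apply/hpsi.
Qed.

(** Points of a finite set are isolated: an interval around [y] with endpoints from [M] meets [X] in
    [y] only, and by the Tarski-Vaught test it contains a point of [X] from [M]. *)
Lemma small_in_base (X : N -> Prop) y :
  Df j (fun v : unit -> N => X (v tt)) -> small X -> X y -> exists m : M, j m = y.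
Proof.
move=> dX sX Xy.
have dX' : Df1 X by apply: Df_reparam dX => m; exists (j m).
have [B hB] := breaks_exist hl hm dX'.
have hXB := small_breaks hO hm hB sX.
have [u0 yu0] := lt_above hO y; have [w0 wy0] := lt_below hO y.
have [u [yu _ hu]] := avoid_right hm B yu0; have [w [wy _ hw]] := avoid_left hm B wy0.
have [p [wp py]] := hdj wy; have [q [yq qu]] := hdj yu.
have [||m [pm [mq Xm]]] := @tarski_vaught (fun y => lt (j p) y /\ lt y (j q) /\ X y).
- by df.
- by exists y.
exists m; have hmB := hXB _ Xm.
have [?|[//|?]] := lt_trich hl (j m) y.
  by case: (hw _ hmB); split; ord hl.
by case: (hu _ hmB); split; ord hl.
Qed.

Lemma Df3_abstract (W : Type) (c : W -> N) (d : N) V (E : (V -> N) -> N -> Prop) :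
  Df2 (oapp c d) E ->
  exists2 F : (V -> N) -> N -> N -> Prop, Df3 c F & forall v y, E v y <-> F v y d.
Proof.
move=> [phi hphi].
exists (fun v y z => sat (ext (oapp c z) (oapp v y)) phi).
  exists (fsubst (fun x => Var (lang N) match x with
     | inl None => inl (Some None) | inl (Some x) => inl (Some (Some x))
     | inr None => inl None | inr (Some w) => inr w end) phi) => v.
  by rewrite sat_fsubst; apply: sat_fvars => -[[x|]|[w|]].
by move=> v y; exact: (hphi (oapp v y)).
Qed.

(** [F] turns the parameter [d] into a variable [z], and [F0] keeps only those [z] whose set is
    small. Two cases arise, according to whether some point of [M] satisfies [F0] for only finitely
    many [z]. *)
Lemma remove_parameter (W : Type) (c : W -> N) (d : N) V (E : (V -> N) -> N -> Prop) :
  (forall m, exists w, c w = j m) ->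
  Df2 (oapp c d) E -> (forall v, small (E v)) ->
  exists E1, [/\ Df2 c E1, forall v, small (E1 v) &
    forall (v : V -> M) m, E (fun x => j (v x)) (j m) -> E1 (fun x => j (v x)) (j m)].
Proof.
move=> hc /Df3_abstract [F dF hF] sE.
pose F0 v y z := F v y z /\ small (fun y' => F v y' z).
have dFi : Df3 (fun a : N => a) F by apply: Df_reparam dF => w; exists (c w).
have dB v : DfB (F0 v) by rewrite /DfB; dfi.
have hFd v y : E v y -> F0 v y d.
  move=> Evy; split; first exact/hF.
  by apply: small_sub (sE v) => y' /hF.
have [[v0 [m0 [E0 s0]]]|no] := pselect (exists (v : V -> M) m,
    E (fun x => j (v x)) (j m) /\ small (F0 (fun x => j (v x)) (j m))).
  (* Here [d] belongs to a finite set definable without it, and the union over this set is a finite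
     union of finite sets. *)
  exists (fun v y => exists z, F0 (fun x => j (v0 x)) (j m0) z /\ F0 v y z); split.
  - by dfi.
  - move=> v; apply: (small_bigU hO hm hd) => //.
    + by rewrite /Df1; dfi.
    + by rewrite /DfB; dfi.
    + by move=> z [p [q [pq h]]]; have [x [px xq]] := hd pq;
         have [_] := h x px xq; apply; exists p, q; split=> // y py yq;
           have [] := h y py yq.
  - by move=> v m Evm; exists d; split; exact: hFd.
(* Here each relevant [y] satisfies [F0] for a whole interval of [z]. If such [y] filled an
   interval, [interval_exchange] would give a single [z] whose set contains an interval. *)
exists (fun v y => ~ small (F0 v y)); split.
- by dfi.
- move=> v [p [q [pq h]]].
  have [z] := interval_exchange hO hm hd pq (dB v) h.
  apply=> -[a [b [ab hab]]]; have [x [ax xb]] := hd ab.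
  have [_ _ [_]] := hab x ax xb; apply; exists a, b; split=> // y ay yb.
  by have [_ _ []] := hab y ay yb.
- by move=> v m Evm s; apply: no; exists v, m.
Qed.

(** Parameters from [M] and the entries of [s], adjoined one by one so that [remove_parameter] can
    discard them in turn. *)
Fixpoint Wl (s : seq N) : Type := if s is _ :: s' then option (Wl s') else M.
Fixpoint cl (s : seq N) : Wl s -> N :=
  match s with [::] => j | d :: s' => oapp (@cl s') d end.

Lemma cl_base s m : exists w, @cl s w = j m.
Proof. by elim: s => [|d s [w hw]] /=; [exists m | exists (Some w)]. Qed.

Lemma cl_in s y : List.In y s -> exists w, @cl s w = y.
Proof.
elim: s => //= d s IH [<-|/IH [w hw]]; first by exists None.
by exists (Some w).
Qed.

Lemma base_cover V (E : (V -> N) -> N -> Prop) :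
  Df2 (fun a : N => a) E -> (forall v, small (E v)) ->
  exists E1, [/\ Df2 j E1, forall v, small (E1 v) &
    forall (v : V -> M) m, E (fun x => j (v x)) (j m) -> E1 (fun x => j (v x)) (j m)].
Proof.
move=> dE sE.
have [m0 _] : exists m : M, lt (zero N) (j m) /\ lt (j m) (one N).
  by apply: hdj; case: hO.
have {dE}[s dE] : exists s, Df2 (@cl s) E.
  case: dE => phi hphi.
  (* The finitely many parameters that occur in the formula; the others are sent to the default
     [m0]. *)
  pose s := pmap (fun x : option V + N =>
    if x is inr a then Some a else None) (fvars phi).
  exists s.
  have /choice [f hf] : forall a, exists w, List.In a s -> @cl s w = a.
    move=> a; have [/cl_in [w hw]|no] := pselect (List.In a s); first by exists w.
    by have [w _] := cl_base s m0; exists w.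
  exists (fsubst (fun x => Var (lang N) match x with inl x => inl x | inr a =>
    inr (f a) end) phi) => v.
  rewrite hphi sat_fsubst; apply: sat_fvars => -[x|a] //= ha; rewrite hf // /s.
  elim: (fvars phi) ha => //= -[x|b] l IH /= [] //; auto.
  by case=> ->; left.
elim: s E sE dE => [|d s IH] E sE dE; first by exists E.
have [E1 [dE1 sE1 h1]] := remove_parameter (cl_base s) dE sE.
have [E2 [dE2 sE2 h2]] := IH E1 sE1 dE1.
by exists E2; split=> // v m /h1/h2.
Qed.

Lemma j_fint n (f : fsym (lang N) n) (x : 'I_n -> M) :
  j (fint M f x) = fint N f (fun i => j (x i)).
Proof.
have := elementary_sat hj (Eq (App f (fun i =>
  Var _ (Some i))) (Var _ None)) (oapp x (fint M f x)).
by move=> /= [/(_ erefl) <- _].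
Qed.

Lemma j_rint n (r : rsym (lang N) n) (x : 'I_n -> M) :
  rint M r x <-> rint N r (fun i => j (x i)).
Proof. exact: (elementary_sat hj (Rel r (fun i => Var _ i)) x). Qed.

Lemma j_inj (x y : M) : j x = j y -> x = y.
Proof.
move=> h; have := elementary_sat hj (Eq (Var _ true) (Var _ false)) (fun b =>
  if b then x else y).
by move=> /= [_ ]; exact.
Qed.

Lemma trace_term V (t : term (trace_lang N) V) :
  exists2 u, Tm (fun a : N => a) u & forall v : V -> M,
    j (eval (v : V -> trace j) t) = u (fun x => j (v x)).
Proof.
elim: t => [x|n f ts IH]; first by exists (fun v => v x) => //; exact: Tm_var.
have /choice [u hu] : forall i, exists u, Tm (fun a : N => a) u /\ forall v : V -> M,
    j (eval (v : V -> trace j) (ts i)) = u (fun x => j (v x)).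
  by move=> i; have [u h1 h2] := IH i; exists u.
exists (fun v => fint N (f : fsym (lang N) n) (fun i => u i v)).
  by apply: (@Tm_app _ N) => i; case: (hu i).
move=> v; rewrite /= j_fint; congr (fint N _ _); apply: funext => i.
by case: (hu i) => _ ->.
Qed.

(** The quantifier is the essential case. Let [E v] be the set of counterexamples in [N]. If it
    contains an interval, density puts a point of [M] into it. If it is small, its points from [M]
    lie in the cover [E1 v], all of whose points come from [M]; so a counterexample in [M] exists
    exactly if [E v] meets [E1 v]. *)
Lemma trace_definable V (phi : formula (trace_lang N) V) :
  exists2 P, Df (fun a : N => a) P & forall v : V -> M,
    @sat _ (trace j) V v phi <-> P (fun x => j (v x)).
Proof.
elim: phi => {V} [V|V a b|V n r ts|V p [P dP hP] q [Q dQ hQ]|V p [P dP hP]].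
- by exists (fun _ => False); first exact: Df_cst.
- have [s ds hs] := trace_term a; have [t dt ht] := trace_term b.
  exists (fun v => s v = t v); first exact: Df_eq.
  by move=> v /=; rewrite -hs -ht; split=> [->|/j_inj].
- have /choice [u hu] : forall i, exists u, Tm (fun a : N => a) u /\ forall v : V -> M,
      j (eval (v : V -> trace j) (ts i)) = u (fun x => j (v x)).
    by move=> i; have [u h1 h2] := trace_term (ts i); exists u.
  have hu' v : (fun i => j (eval (v : V -> trace j) (ts i))) = (fun i =>
    u i (fun x => j (v x))).
    by apply: funext => i; case: (hu i) => _ ->.
  case: r => [r|[D [psi hpsi]]].
    exists (fun v => rint N r (fun i => u i v)).
      by apply: Df_rel => i; case: (hu i).
    by move=> v; rewrite -hu'; exact: j_rint.
  exists (fun v => D (fun i => u i v)); last by move=> v; rewrite -hu'.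
  apply: Df_subst => [|i]; last by case: (hu i).
  by exists (unconst psi) => x; rewrite hpsi sat_unconst.
- exists (fun v => P v -> Q v); first exact: Df_imp.
  by move=> v /=; rewrite hP hQ.
have [E dE hE] : exists2 E, Df2 (fun a : N =>
  a) E & forall v y, E v y <-> ~ P (oapp v y).
  exists (fun v y => ~ P (oapp v y)) => //; apply: Df_not; apply: Df_ext dP => v.
  by suff -> : v = oapp (fun x => v (Some x)) (v None) by []; apply: funext => -[].
have [||E1 [dE1 sE1 hE1]] := @base_cover V (fun v y => E v y /\ small (E v)).
- by dfi.
- by move=> v [p' [q [pq h]]]; have [x [px xq]] := hd pq; have [_ ] := h x px xq; apply;
    exists p', q; split=> // y py yq; have [] := h y py yq.
have dE1i : Df2 (fun a : N => a) E1 by apply: Df_reparam dE1 => m; exists (j m).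
exists (fun v => small (E v) /\ forall y, ~ (E v y /\ E1 v y)); first by dfi.
move=> v /=; have hPE a : @sat _ (trace j) _ (oapp v a) p <-> ~ E (fun x =>
  j (v x)) (j a).
  rewrite hP hE; suff -> : (fun x => j (oapp v a x)) = oapp (fun x => j (v x)) (j a).
    by split=> [? //|/contrapT].
  by apply: funext => -[].
split=> [h|[sE h] a].
  split=> [[p' [q [pq hpq]]]|y [Ey E1y]].
    have [m [pm mq]] := hdj pq.
    by have /hPE := h m; apply; exact: hpq.
  have [m hmy] : exists m, j m = y.
    apply: (@small_in_base (E1 (fun x => j (v x)))) => //.
    by apply: (Df2_app dE1); tm.
  by have /hPE := h m; apply; rewrite hmy.
by apply/hPE => Ea; apply: (h (j a)); split=> //; exact: hE1.
Qed.

End DensePair.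

(** * Ultrapowers *)

Section Ultrapower.
Variables (L : language) (M : structure L) (I : Type) (U : (I -> Prop) -> Prop).
Hypothesis hU : UltraFilter U.

Let pU : ProperFilter U := @ultra_proper _ U hU.

Lemma U_sub (A B : I -> Prop) : (forall e, A e -> B e) -> U A -> U B.
Proof. exact: filterS. Qed.

Lemma U_and (A B : I -> Prop) : U A -> U B -> U (fun e => A e /\ B e).
Proof. exact: filterI. Qed.

Lemma U_all (A : I -> Prop) : (forall e, A e) -> U A.
Proof. by move=> h; apply: filterS (@filterT _ U _) => e _; exact: h. Qed.

Lemma U_false (A : I -> Prop) : (forall e, ~ A e) -> ~ U A.
Proof.
move=> h hA; apply: (filter_not_empty U).
by apply: filterS hA => e /h.
Qed.

Lemma U_not (A : I -> Prop) : U (fun e => ~ A e) <-> ~ U A.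
Proof.
split=> [h1 h2|h].
  by have := U_and h1 h2; apply: U_false => e [].
by case: (in_ultra_setVsetC A hU).
Qed.

Lemma U_fin n (A : 'I_n -> I -> Prop) : (forall i, U (A i)) -> U (fun e =>
  forall i, A i e).
Proof.
move=> h; suff : U (fun e => forall i, i \in enum 'I_n -> A i e).
  by apply: U_sub => e he i; apply: he; rewrite mem_enum.
elim: (enum 'I_n) => [|k s IH]; first exact: U_all.
by apply: U_sub (U_and (h k) IH) => e [hk hs] i; rewrite inE => /orP [/eqP ->|/hs].
Qed.

(** Choosing a counterexample at each index where there is one gives the quantifier step of the
    theorem of Los. *)
Lemma U_forall (B : I -> M -> Prop) :
  (forall x : I -> M, U (fun e => B e (x e))) -> U (fun e => forall y, B e y).
Proof.
move=> h; apply: contrapT => hn0; have /U_not hn := hn0.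
have [m0] : inhabited M.
  apply: contrapT => no; apply: hn0; apply: U_all => e y; case: no.
  by exists.
have /choice [x hx] : forall e, exists y, ~ (forall y, B e y) -> ~ B e y.
  move=> e; have [hB|/existsNP [y hy]] := pselect (forall y, B e y); last by exists y.
  by exists m0.
by have := U_and hn (h x); apply: U_false => e [/hx].
Qed.

Definition eqU (f g : I -> M) := U (fun e => f e = g e).

Definition ultra_carrier : Type := {P : (I -> M) -> Prop | exists f, P = eqU f}.

Definition cls (f : I -> M) : ultra_carrier := exist _ (eqU f) (ex_intro _ f erefl).

Lemma clsP f g : cls f = cls g <-> U (fun e => f e = g e).
Proof.
split=> [[h]|h].
  suff : eqU f g by [].
  by rewrite h; exact: U_all.
apply: eq_exist; apply: funext => k; apply: propext.
by split=> hk; apply: U_sub (U_and h hk) => e [-> ].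
Qed.

Lemma cls_surj x : exists f, cls f = x.
Proof. by case: x => P [f hf]; exists f; apply: eq_exist. Qed.

Definition rep (x : ultra_carrier) : I -> M := projT1 (cid (cls_surj x)).

Lemma repK x : cls (rep x) = x.
Proof. exact: (projT2 (cid (cls_surj x))). Qed.

Lemma rep_cls f : U (fun e => rep (cls f) e = f e).
Proof. by apply/clsP; rewrite repK. Qed.

Definition ultrapower : structure L :=
  @Structure L ultra_carrier
    (fun n f x => cls (fun e => fint M f (fun i => rep (x i) e)))
    (fun n r x => U (fun e => rint M r (fun i => rep (x i) e))).

Lemma eval_ultrapower V (v : V -> I -> M) (t : term L V) :
  @eval _ ultrapower V (fun x => cls (v x)) t = cls (fun e => eval (fun x => v x e) t).
Proof.
elim: t => [//|n f ts IH] /=; apply/clsP.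
have h : U (fun e => forall i, rep (cls (fun e => eval (fun x => v x e) (ts i))) e =
   eval (fun x => v x e) (ts i)) by apply: U_fin => i; exact: rep_cls.
apply: U_sub h => e he; congr (fint M f _); apply: funext => i; by rewrite IH he.
Qed.

Lemma los V (phi : formula L V) (v : V -> I -> M) :
  @sat _ ultrapower V (fun x => cls (v x)) phi <-> U (fun e => sat (fun x =>
    v x e) phi).
Proof.
elim: phi v => {V} /= [V|V a b|V n r ts|V p IHp q IHq|V p IH] v.
- by split=> [[]|h]; apply: (@U_false (fun _ => False) _ h) => e [].
- by rewrite !eval_ultrapower clsP.
- have h : U (fun e => forall i, rep (cls (fun e => eval (fun x => v x e) (ts i))) e =
     eval (fun x => v x e) (ts i)) by apply: U_fin => i; exact: rep_cls.
  have E e : (forall i, rep (cls (fun e => eval (fun x => v x e) (ts i))) e =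
     eval (fun x => v x e) (ts i)) ->
     (fun i => rep (@eval _ ultrapower V (fun x => cls (v x)) (ts i)) e) =
     (fun i => eval (fun x => v x e) (ts i)).
    by move=> he; apply: funext => i; rewrite eval_ultrapower he.
  by split=> h'; apply: U_sub (U_and h h') => e [/E ->].
- rewrite IHp IHq; split=> [h|h hp].
    have [hp|/U_not hp] := lem (U (fun e => sat (fun x => v x e) p)).
      by apply: U_sub (h hp).
    by apply: U_sub hp.
  by apply: U_sub (U_and h hp) => e [hpq]; exact: hpq.
- have E (x : I -> M) : @sat _ ultrapower _ (oapp (fun x => cls (v x)) (cls x)) p <->
      U (fun e => sat (oapp (fun x => v x e) (x e)) p).
    have -> : oapp (fun x => cls (v x)) (cls x) = (fun y => cls (oapp v x y)).
      by apply: funext => -[].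
    rewrite IH; suff -> : (fun e => sat (fun y => oapp v x y e) p) =
       (fun e => sat (oapp (fun x => v x e) (x e)) p) by [].
    apply: funext => e; congr sat; by apply: funext => -[].
  split=> [h|h a].
    by apply: U_forall => x; apply/E; exact: h.
  have [x <-] := cls_surj a; apply/E; exact: U_sub h.
Qed.

End Ultrapower.

(** * Isolated types over a subset of an ultrapower *)

Section CompleteFormulas.
Variables (L : language) (M : structure L) (U : ((nat -> M) -> Prop) -> Prop).
Hypothesis hU : UltraFilter U.

Local Notation M' := (ultrapower M U).

Definition set_one (L' : language) (theta : formula L' 'I_1) : sentence L' :=
  All (fsubst (fun _ => Var L' None) theta).

Lemma holds_set_one (L' : language) (S : structure L') (theta : formula L' 'I_1) :
  holds S (set_one theta) <-> forall a, sat (fun _ => a : S) theta.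
Proof. by rewrite /holds /=; split=> h a; have := h a; rewrite sat_fsubst. Qed.

(* Over the diagonal and the coordinates of the ultrapower M^(nat -> M) / U, a
   consistent definable set contains one that isolates a complete type. *)
Lemma complete_formula (P : (nat -> M) -> M -> Prop) :
  has_atomic_models_over_sets (Th M) -> Df2 (fun a : M => a) P ->
  U (fun e => exists x, P e x) ->
  exists Q, [/\ Df2 (fun a : M => a) Q, U (fun e => exists x, Q e x),
    U (fun e => forall x, Q e x -> P e x) &
    forall R, Df2 (fun a : M => a) R ->
      U (fun e => forall x, Q e x -> R e x) \/ U (fun e => forall x, Q e x -> ~ R e x)].
Proof.
move=> hat dP exP.
have mM' : models M' (Th M).
  move=> phi hphi; rewrite /holds.
  have -> : of_void M' = (fun x =>
    cls U (of_void ((nat -> M) -> M) x)) by apply: funext => -[].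
  apply/los => //; apply: U_all => // e.
  by have -> : (fun x => of_void ((nat -> M) ->
    M) x e) = of_void M by apply: funext => -[].
(* As the indices are sequences, each coordinate function is an element of the ultrapower; [A]
   consists of these and of the constant functions. *)
pose val (x : M + nat) (e : nat -> M) := match x with inl m => m | inr n => e n end.
pose A (a : M') := exists x, a = cls U (val x).
have /choice [code hcode] : forall c : {a : M' | A a}, exists x, sval c = cls U (val x).
  by case=> a [x hx]; exists x.
pose con x : {a : M' | A a} := exist _ (cls U (val x)) (ex_intro _ x erefl).
pose MA := with_consts (fun c : {a : M' | A a} => sval c).
have [K [hK atK]] := hat M' mM' A.
(* A complete theory transfers in both directions. *)
have {}hK phi : holds K phi <-> holds MA phi.
  split=> [h|]; last exact: hK.
  apply: contrapT => hn; suff : holds K (Imp phi (Bot _ _)) by apply.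
  by apply: hK.
(* [toA] and [ofA] match formulas over [A] in one variable with families [R e x] definable over [M],
   where the constants for coordinates become the entries of [e]. *)
have toA R : Df2 (fun a : M => a) R -> exists theta, forall x : (nat -> M) -> M,
    @sat _ MA _ (fun _ : 'I_1 => cls U x) theta <-> U (fun e => R e (x e)).
  move=> [phi hphi].
  exists (to_const (fun y : option nat + M => match y with
     | inl None => inl ord0 | inl (Some n) => inr (con (inr n)) | inr m =>
       inr (con (inl m)) end) phi).
  move=> x; rewrite sat_to_const.
  pose w (y : option nat + M) : (nat -> M) -> M := match y with
     | inl None => x | inl (Some n) => val (inr n) | inr m => val (inl m) end.
  have -> : (fun y : option nat + M => ext (fun c => sval c) (fun _ : 'I_1 => cls U x)
     match y with
     | inl None => inl ord0 | inl (Some n) => inr (con (inr n)) | inr m =>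
       inr (con (inl m)) end)
     = (fun y => cls U (w y)) by apply: funext => -[[n|]|m].
  rewrite los //; suff -> : (fun e => sat (fun y => w y e) phi) = (fun e =>
    R e (x e)) by [].
  apply: funext => e; apply: propext; rewrite (hphi (oapp e (x e))).
  by apply: sat_fvars => -[[n|]|m].
have ofA theta : exists2 R, Df2 (fun a : M => a) R & forall x : (nat -> M) -> M,
    @sat _ MA _ (fun _ : 'I_1 => cls U x) theta <-> U (fun e => R e (x e)).
  pose w (e : nat -> M) x (y : 'I_1 + {a : M' | A a}) :=
    match y with inl _ => x | inr c => val (code c) e end.
  exists (fun e x => sat (w e x) (unconst theta)).
    exists (fsubst (fun y => Var L match y with inl _ => inl None | inr c =>
      match code c with inl m => inr m | inr n =>
        inl (Some n) end end) (unconst theta)) => v.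
    rewrite sat_fsubst; apply: sat_fvars => -[i|c] _ //=.
    by case: (code c).
  move=> x; rewrite sat_unconst.
  have -> : ext (fun c : {a : M' | A a} => sval c) (fun _ : 'I_1 => cls U x) =
      (fun y => cls U (fun e => w e (x e) y)).
    by apply: funext => -[i|c] //=; rewrite hcode.
  by rewrite los.
have tr theta R : (forall x : (nat -> M) -> M,
     @sat _ MA _ (fun _ : 'I_1 => cls U x) theta <-> U (fun e => R e (x e))) ->
     holds K (set_one theta) <-> U (fun e => forall x, R e x).
  move=> h; rewrite hK holds_set_one; split=> [hall|hall a].
    by apply: U_forall => // x; apply/h.
  by have [x <-] := cls_surj a; apply/h; apply: U_sub hall.
(* Inclusion of one definable set in another is expressed by a sentence, so it passes between [K]
   and almost all indices. *)
have timp th1 R1 th2 R2 : (forall x : (nat -> M) -> M,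
     @sat _ MA _ (fun _ : 'I_1 => cls U x) th1 <-> U (fun e => R1 e (x e))) ->
     (forall x : (nat -> M) -> M,
     @sat _ MA _ (fun _ : 'I_1 => cls U x) th2 <-> U (fun e => R2 e (x e))) ->
     (forall a : K, sat (fun _ => a) th1 -> sat (fun _ => a) th2) <->
     U (fun e => forall x, R1 e x -> R2 e x).
  move=> h1 h2; rewrite -(tr (Imp th1 th2)) ?holds_set_one // => x /=; rewrite h1 h2.
  split=> [h|h h']; last by apply: U_sub (U_and hU h h') => e []; exact.
  have [h'|/(U_not hU) h'] := lem (U (fun e => R1 e (x e))).
    by apply: U_sub (h h').
  by apply: U_sub h'.
have hbot (x : (nat -> M) -> M) :
    @sat _ MA _ (fun _ : 'I_1 => cls U x) (Bot _ _) <-> U (fun e => False).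
  by split=> [[]|h]; case: (U_false hU _ h) => e [].
have tex theta R : (forall x : (nat -> M) -> M,
     @sat _ MA _ (fun _ : 'I_1 => cls U x) theta <-> U (fun e => R e (x e))) ->
     (exists a : K, sat (fun _ => a) theta) <-> U (fun e => exists x, R e x).
  move=> h; have E := timp _ _ _ (fun _ _ => False) h hbot.
  split=> [[a ha]|hR]; apply: contrapT => hn.
    suff /E/(_ a ha) : U (fun e => forall x, R e x -> False) by [].
    by have /(U_not hU) := hn; apply: U_sub => e he x Rx; apply: he; exists x.
  have : U (fun e => forall x, R e x -> False).
    by apply/E => a ha; apply: hn; exists a.
  by move=> /(U_and hU hR); apply: U_false => e [[x Rx] /(_ x)].
have [phi0 hphi0] := toA _ dP.
have [b hb] := (tex _ _ hphi0).2 exP.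
(* [psi] isolates the type of a realisation [b] of [P]; completeness of [Q] reflects completeness of
   that type. *)
have [psi [psib hpsi]] := atK 1 (fun _ => b).
have [Q dQ hQ] := ofA psi.
exists Q; split=> //.
- by apply/(tex _ _ hQ); exists b.
- by apply/(timp _ _ _ _ hQ hphi0) => a; exact: hpsi.
move=> R /toA [theta htheta].
have [h|h] := lem (sat (fun _ : 'I_1 => b) theta); [left|right].
  by apply/(timp _ _ _ _ hQ htheta) => a; exact: hpsi.
apply/(timp _ _ (Imp theta (Bot _ _)) (fun e x => ~ R e x) hQ).
  by move=> x /=; rewrite htheta (U_not hU).
by move=> a; exact: (hpsi (Imp theta (Bot _ _))).
Qed.

End CompleteFormulas.

(** * Fast decreasing sequences *)

Definition upd (X : Type) (v : nat -> X) (k : nat) (t : X) (i : nat) : X :=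
  if i == k then t else v i.

Definition depends_below (X : Type) (n : nat) (P : (nat -> X) -> Prop) : Prop :=
  forall v v', (forall i, i < n -> v i = v' i) -> P v -> P v'.

Lemma Df2_upd (L : language) (S : structure L) (W : Type) (c : W -> S)
    (E : (nat -> S) -> S -> Prop) k :
  Df2 c E -> Df3 c (fun v t y => E (upd v k t) y).
Proof.
move=> dE; apply: (Df2_app (t := fun x v => upd (fun x =>
  v (Some (Some x))) k (v (Some None)) x) dE).
  by move=> x; rewrite /upd; case: (x == k); exact: Tm_var.
exact: Tm_var.
Qed.

Lemma Df2_depends (L : language) (S : structure L) (W : Type) (c : W -> S)
    (E : (nat -> S) -> S -> Prop) :
  Df2 c E -> exists n, forall y, depends_below n (E^~ y).
Proof.
move=> [phi hphi].
exists (foldr maxn 0 [seq if x is inl (Some i) then i.+1 else 0 | x <- fvars phi]).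
move=> y v v' hv; have := hphi (oapp v y); have := hphi (oapp v' y) => /= -> ->.
suff /sat_fvars-> : forall x, List.In x (fvars phi) ->
  ext c (oapp v y) x = ext c (oapp v' y) x by [].
move=> [[i|]|w] //= hi; apply: hv.
elim: (fvars phi) hi => //= x s IH [->|/IH h]; first by rewrite leq_maxl.
by rewrite leq_max h orbT.
Qed.

(** Converse of [breaks_exist]: an entry of [C] inside the current interval splits it in two, and
    once none is left [X] contains all of the interval or none of it. *)
Lemma finite_union (M : og_structure) (hl : linear_order M) (X : M ->
  Prop) (C : seq M) P Q :
  (forall x y, in_interval (P, Q) x -> in_interval (P, Q) y -> lt x y ->
     (forall b, List.In b C -> lt b x \/ lt y b) -> (X x <-> X y)) ->
  exists points intervals, forall x, (in_interval (P, Q) x /\ X x) <->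
    List.In x points \/ exists2 J, List.In J intervals & in_interval (M := M) J x.
Proof.
elim: C P Q => [|c C IH] P Q hX.
  have [[x [hx Xx]]|no] := lem (exists x, in_interval (P, Q) x /\ X x).
    exists [::], [:: (P, Q)] => y; split=> [[hy _]|[//|[J [<-|//] hy]]].
      by right; exists (P, Q); [left|].
    split=> //; have [xy|[<-//|yx]] := lt_trich hl x y; first by apply/(hX x y).
    by apply/(hX y x).
  exists [::], [::] => y; split=> [[hy Xy]|[//|[J //]]].
  by case: no; exists y.
have [hc|hc] := lem (in_interval (P, Q) c); last first.
  apply: IH => x y hx hy xy hb; apply: hX => // b /= [<-|/hb //].
  have [?|[e|cx]] := lt_trich hl c x; [by left|by case: hc; rewrite e|].
  have [cy|[e|?]] := lt_trich hl c y; [|by case: hc; rewrite e|by right].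
  case: hc; split; case: hx hy => /= h1 h2 [h3 h4].
    by case: (P) h1 => //= a ?; ord hl.
  by case: (Q) h4 => //= a ?; ord hl.
have sub1 x : in_interval (P, Some c) x -> in_interval (P, Q) x.
  case=> h1 /= h2; split=> //; case: hc => _ /=; case: (Q) => //= a ?; ord hl.
have sub2 x : in_interval (Some c, Q) x -> in_interval (P, Q) x.
  case=> /= h1 h2; split=> //; case: hc => /=; case: (P) => //= a ? _; ord hl.
have [|p1 [i1 h1]] := IH P (Some c).
  move=> x y hx hy xy hb; apply: hX; [exact: sub1|exact: sub1| by []|].
  by move=> b /= [<-|/hb //]; right; case: hy.
have [|p2 [i2 h2]] := IH (Some c) Q.
  move=> x y hx hy xy hb; apply: hX; [exact: sub2|exact: sub2| by []|].
  by move=> b /= [<-|/hb //]; left; case: hx.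
exists (p1 ++ p2 ++ (if pselect (X c) then [:: c] else [::])), (i1 ++ i2) => x.
have -> : (in_interval (P, Q) x /\ X x) <->
   (in_interval (P, Some c) x /\ X x) \/ (in_interval (Some c, Q) x /\ X x) \/ (x = c
     /\ X c).
  split=> [[hx Xx]|[[/sub1 ? ?]|[[/sub2 ? ?]|[-> ?]]]] //.
  case: (hx) => a b; have [?|[?|?]] := lt_trich hl x c;
    [left|right;right|right;left]; split=> //.
  by subst c.
rewrite h1 h2 !In_cat.
have -> : List.In x (if pselect (X c) then [:: c] else [::]) <-> x = c /\ X c.
  by case: pselect => h /=; split=> [[]|[]] //; auto.
have -> : (exists2 J, List.In J (i1 ++ i2) & in_interval J x) <->
   (exists2 J, List.In J i1 & in_interval J x) \/ (exists2 J, List.In J i2 &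
     in_interval J x).
  split=> [[J]|[[J h]|[J h]]]; first by rewrite In_cat => -[]; [left|right]; exists J.
    by exists J => //; rewrite In_cat; left.
  by exists J => //; rewrite In_cat; right.
tauto.
Qed.

Section Trace.
Variables (N : og_structure) (hO : ordered_group N) (hm : o_minimal N).
Variables (M : structure (lang N)) (j : M -> N) (hj : elementary_embedding j).
Hypothesis hdj : forall a b : N, lt a b -> exists x : M, lt a (j x) /\ lt (j x) b.

Let hl : linear_order N := hm.1.
Let hd := dense_order hdj.

Definition pos (e : M) : Prop := lt (zero N) (j e).

Lemma pos_below (w : N) : lt (zero N) w -> exists d, pos d /\ lt (j d) w.
Proof. by move=> /hdj [d [h1 h2]]; exists d. Qed.

(* Generated by the sets of sequences in which every term is positive and
   sufficiently small with respect to the previous ones. *)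
Definition fastF (A : (nat -> M) -> Prop) : Prop :=
  exists2 delta : seq M -> M, (forall s, pos (delta s)) &
    forall e : nat -> M,
      (forall n, pos (e n) /\ lt (j (e n)) (j (delta (mkseq e n)))) -> A e.

Lemma zero_one : lt (zero N) (one N). Proof. by case: hO. Qed.

Lemma pos_min d1 d2 : pos d1 -> pos d2 -> exists d, pos d /\
  forall t : N, lt t (j d) -> lt t (j d1) /\ lt t (j d2).
Proof.
move=> h1 h2; have [?|?] := lem (lt (j d1) (j d2)); [exists d1|exists d2];
  split=> // t ht; split=> //; ord hl.
Qed.

Lemma fastF_pos : fastF (fun e => forall n, pos (e n)).
Proof.
have [d [d0 _]] := pos_below zero_one.
by exists (fun _ => d) => // e he n; case: (he n).
Qed.

Lemma fastF_sub (A B : (nat -> M) -> Prop) : (forall e, A e -> B e) -> fastF A ->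
  fastF B.
Proof. by move=> AB [d d0 hd']; exists d => // e /hd' /AB. Qed.

Lemma fastF_and (A B : (nat -> M) -> Prop) : fastF A -> fastF B -> fastF (fun e =>
  A e /\ B e).
Proof.
move=> [d1 p1 h1] [d2 p2 h2].
have /choice [d hd'] : forall s, exists d, pos d /\
  forall t : N, lt t (j d) -> lt t (j (d1 s)) /\ lt t (j (d2 s)) by move=> s;
    exact: pos_min.
exists d => [s|e he]; first by case: (hd' s).
by split; [apply: h1 | apply: h2] => n; have [en /(hd' _).2 []] := he n.
Qed.

Lemma fastF_nonempty (A : (nat -> M) -> Prop) : fastF A -> exists e, A e.
Proof.
move=> [d d0 hA].
have /choice [g hg] : forall s, exists x, pos x /\ lt (j x) (j (d s)).
  by move=> s; exact: pos_below (d0 s).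
pose pre := fix pre n := if n is n'.+1 then rcons (pre n') (g (pre n')) else [::].
exists (fun n => g (pre n)); apply: hA => n.
suff -> : mkseq (fun n => g (pre n)) n = pre n by exact: hg.
by elim: n => //= n IH; rewrite /mkseq -addn1 iotaD map_cat -/(mkseq _ n) IH -cats1.
Qed.

Lemma fastF_filter : ProperFilter (fastF : set_system (nat -> M)).
Proof.
constructor; first by move=> /fastF_nonempty [].
constructor.
- by have := fastF_pos; apply: fastF_sub.
- by move=> A B hA hB; exact: fastF_and.
- by move=> A B AB; apply: fastF_sub.
Qed.

(** The threshold [d] can be chosen from the first [n] entries of [e] alone, as [A] depends only on
    these and [B] on no entry after index [n]; so it can be built into the bound for the [n]-th
    entry. *)
Lemma fastF_step n (A B : (nat -> M) -> Prop) :
  depends_below n A -> depends_below n.+1 B ->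
  (forall e, A e -> exists d, pos d /\ forall t, pos t -> lt (j t) (j d) ->
    B (upd e n t)) ->
  fastF A -> fastF B.
Proof.
move=> dA dB h /(fastF_and fastF_pos) [d d0 hA].
(* [m0] pads a finite prefix to a sequence. *)
have [m0 _] := pos_below zero_one.
have /choice [d1 hd1] : forall s, exists d, pos d /\
    (A (nth m0 s) -> forall t, pos t -> lt (j t) (j d) -> B (upd (nth m0 s) n t)).
  move=> s; have [/h [x [x0 hx]]|no] := lem (A (nth m0 s)); first by exists x.
  by have [x [x0 _]] := pos_below zero_one; exists x.
have /choice [d2 hd2] : forall s, exists x, pos x /\
  forall t : N, lt t (j x) -> lt t (j (d s)) /\ lt t (j (d1 s)).
  by move=> s; apply: pos_min => //; case: (hd1 s).
exists d2 => [s|e he]; first by case: (hd2 s).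
have [] : (forall n, pos (e n)) /\ A e.
  by apply: hA => k; have [ek /(hd2 _).2 []] := he k.
move=> epos Ae; have agree i : i < n -> e i = nth m0 (mkseq e n) i by move=> hi;
  rewrite nth_mkseq.
have := (hd1 (mkseq e n)).2 (dA _ _ agree Ae) (e n) (epos n).
have [_ /(hd2 _).2 [_ h1]] := he n.
move=> /(_ h1); apply: dB => i; rewrite ltnS leq_eqVlt /upd => /orP [/eqP ->|hi].
  by rewrite eqxx.
by rewrite ltn_eqF // -agree.
Qed.

Lemma j_upd (e : nat -> M) k t : (fun i => j (upd e k t i)) = upd (fun i =>
  j (e i)) k (j t).
Proof. by apply: funext => i; rewrite /upd; case: eqP. Qed.

(** Induction on the number of coordinates, letting the last one tend to 0: if the limit set avoids
    the interval from [r - e 0] to [r], then by [limset_avoid] so does [E] once the last coordinate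
    is small enough. *)
Lemma fastF_avoid (r : N) (E : (nat -> N) -> N -> Prop) n :
  (forall m, j m <> r) -> Df2 j E -> (forall v, small (E v)) ->
  (forall y, depends_below n.+1 (E^~ y)) ->
  fastF (fun e => forall y, ~ lt y (add r (opp (j (e 0)))) -> ~ lt r y ->
    ~ E (fun i => j (e i)) y).
Proof.
move=> rj; have base (X : N -> Prop) : Df j (fun v : unit -> N =>
  X (v tt)) -> small X -> ~ X r.
  by move=> dX sX /(small_in_base hO hm hj hdj dX sX) [m /rj].
have param k (E0 : (nat -> N) -> N -> Prop) : Df2 j E0 ->
  exists F, [/\ Df3 j F, Df3 (fun a : N => a) F &
    forall v t y, F v t y = E0 (upd v k t) y].
  move=> dE0; exists (fun v t y => E0 (upd v k t) y); split=> //; first exact: Df2_upd.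
  by apply: Df_reparam (Df2_upd k dE0) => m; exists (j m).
elim: n E => [|n IH] E dE sE depE; last first.
  have [F [dF dFi FE]] := param n.+1 E dE.
  pose lim v := limset (F v).
  have dB v : DfB (F v) by rewrite /DfB; dfi.
  have dlim : Df2 j lim by rewrite /lim /limset; dfi.
  have slim v : small (lim v).
    by apply: (limset_small hO hm hd) => // t; rewrite (funext (FE v t)).
  have deplim y : depends_below n.+1 (lim^~ y).
    move=> v v' hv; suff -> : lim v = lim v' by [].
    rewrite /lim; congr limset; apply: funext => t; apply: funext => z; rewrite !FE.
    by apply: propext; split; apply: depE => i; rewrite ltnS /upd leq_eqVlt;
      case: eqP => //= _ /hv ->.
  apply: (@fastF_step n.+1 _ _ _ _ _ (IH lim dlim slim deplim)).
  - move=> v v' hv h y; rewrite -hv // => h1 h2.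
    by move=> h3; apply: (h y h1 h2); apply: (deplim y _ _ _ h3) => i hi; rewrite hv.
  - move=> v v' hv h y; rewrite -hv // => h1 h2.
    by move=> h3; apply: (h y h1 h2); apply: (depE y _ _ _ h3) => i hi; rewrite hv.
  - move=> e /(limset_avoid hO hm hd (dB _)) [w [/pos_below [d [d0 dw]] hw]].
    exists d; split=> // t t0 td y hy1 hy2; rewrite j_upd -FE; apply: hw => //.
    by ord hl.
have [F [dF dFi FE]] := param 0 E dE.
(* Only coordinate 0 is left. Its limit set is a small set definable over [M], hence does not
   contain [r]; [m0] fills the coordinates that [E] does not see. *)
have [m0 _] := pos_below zero_one.
have dB : DfB (F (fun _ => j m0)) by rewrite /DfB; dfi.
have dlim : Df j (fun v : unit -> N => limset (F (fun _ => j m0)) (v tt)).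
  by rewrite /limset; dfi.
have nlim : ~ limset (F (fun _ => j m0)) r.
  by apply: base dlim _; apply: (limset_small hO hm hd) => // t;
    rewrite (funext (FE _ t)).
have [p [q [pr [rq [w [w0 hw]]]]]] : exists p q, lt p r /\ lt r q /\
    near_right (zero N) (fun t => forall z, lt p z -> lt z q -> ~ F (fun _ =>
      j m0) t z).
  apply: contrapT => no; apply: nlim => p q pr rq h; apply: no; by exists p, q.
have [d1 [d10 d1w]] := pos_below w0.
(* Below this bound [r - e 0] stays above [p]. *)
have [d2 [d20 d2w]] : exists d, pos d /\ lt (j d) (add (opp p) r).
  by apply: pos_below; rewrite -(addN hO p); exact: add_ltl.
have [d [d0 hmin]] := pos_min d10 d20.
apply: (@fastF_step 0 (fun _ => True)); [by []| | |exact: fastF_sub fastF_pos].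
  move=> v v' hv h y; rewrite -hv // => h1 h2.
  by move=> h3; apply: (h y h1 h2); apply: (depE y _ _ _ h3) => i hi; rewrite hv.
move=> e _; exists d; split=> // t t0 /hmin [t1 t2] y hy1 hy2 Ey.
have hyt : ~ lt y (add r (opp (j t))) by exact: hy1.
have pt : lt (add p (j t)) r by rewrite -(addNK hO p r); apply: (add_ltl hO); ord hl.
have prt := add_ltr hO (opp (j t)) pt; rewrite (addKNr hO) in prt.
have tw : lt (j t) w by ord hl.
apply: (hw (j t) t0 tw y); [by clear hy1; ord hl | by clear hy1 hyt; ord hl|].
rewrite FE; apply: (depE y _ _ _ Ey) => -[|i] // _; by rewrite /upd.
Qed.

End Trace.

(** * Ordered group reducts *)

Section Reduct.
Variables (N : og_structure) (hO : ordered_group N) (hm : o_minimal N).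
Variables (M : structure (lang N)) (j : M -> N) (hj : elementary_embedding j).
Hypothesis hdj : forall a b : N, lt a b -> exists x : M, lt a (j x) /\ lt (j x) b.

Let hl : linear_order N := hm.1.
Let hd := dense_order hdj.

Variables (L : language) (g : og_symbols L).
Variables (Rf : forall n, fsym L n -> ('I_n -> M) -> M).
Variables (Rr : forall n, rsym L n -> ('I_n -> M) -> Prop).
Let S : structure L := @Structure L M Rf Rr.
Let R : og_structure := OgStructure g S.

Hypothesis hlt : forall x y : M, @lt R x y <-> lt (j x) (j y).
Hypothesis hadd : forall x y : M, j (@add R x y) = add (j x) (j y).
Hypothesis htr : forall V (phi : formula L V),
  exists2 P, Df (fun a : N => a) P & forall v : V -> M,
    @sat _ S V v phi <-> P (fun x => j (v x)).

Lemma reduct_trace V (P : (V -> M) -> Prop) : @Df _ S _ (fun a => a) V P ->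
  exists2 D, Df (fun a : N => a) D & forall v : V -> M, P v <-> D (fun x => j (v x)).
Proof.
move=> [phi hphi]; have [D dD hD] := htr phi.
exists (fun v => D (fun x => match x with inl x => v x | inr a => j a end)).
  by apply: (Df_subst (t := fun x v => match x with inl x => v x | inr a =>
    j a end) dD) => -[x|a]; tm.
move=> v; rewrite hphi hD.
suff -> : (fun x => j (ext (fun a => a) v x)) =
    (fun x => match x with inl x => j (v x) | inr a => j a end) by [].
by apply: funext => -[].
Qed.

Lemma reduct_linear : linear_order R.
Proof.
split.
- by move=> x /hlt; exact: (ltxx hl).
- by move=> x y z /hlt h1 /hlt h2; apply/hlt; exact: (lt_tr hl h1).
- move=> x y; have [h|[h|h]] := lt_trich hl (j x) (j y).
  + by left; apply/hlt.
  + by right; left; apply: (j_inj hj).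
  + by right; right; apply/hlt.
Qed.
Let hR := reduct_linear.

(** Although [P] may have no supremum in [M], it has one in [N], and any point of [P] above that
    supremum minus [e] will do. *)
Lemma definable_sup (P : M -> Prop) (b : N) (e : M) :
  @Df _ S _ (fun a => a) unit (fun v => P (v tt)) ->
  (exists x, P x) -> (forall x, P x -> lt (j x) b) -> lt (zero N) (j e) ->
  exists2 x, P x & forall y, P y -> lt (j y) (add (j x) (j e)).
Proof.
move=> dP [x0 Px0] hb e0.
have [D dD hD] : exists2 D, Df1 D & forall z, D (j z) <->
  exists2 x, P x & ~ lt (j x) (j z).
  have [|D0 dD0 hD0] := @reduct_trace unit (fun v => exists x, P x /\ ~ @lt R x (v tt)).
    apply: Df_ex; apply: Df_and; first by apply: (Df_subst (t := fun _ v =>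
      v None) dP) => _; exact: Tm_var.
    by apply: Df_not; apply: (@Df_lt R) => //; exact: Tm_var.
  exists (fun y => D0 (fun _ => y)).
    by apply: (Df_ext _ dD0) => v; suff -> : v = (fun _ => v tt) by [];
      apply: funext => -[].
  move=> z; rewrite -(hD0 (fun _ => z)); split=> [[x [Px h]]|[x Px h]]; exists x => //.
    by move=> /hlt.
  by split=> // /hlt.
(* [D] agrees with the downward closure of [P] on [M] only. Ignoring small sets of exceptions turns
   it into an initial segment of [N], to which [cut_exists] applies. *)
pose Y (y : N) := small (fun z => lt z y /\ ~ D z).
have YD z : D (j z) -> Y (j z).
  move=> /hD [x Px xz] [p [q [pq h]]]; have [m [pm mq]] := hdj pq.
  have [mz] := h _ pm mq; apply; apply/hD; exists x => //; ord hl.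
have nYD z y : ~ D (j z) -> lt (j z) y -> ~ Y y.
  move=> nDz zy sY.
  have [h|h] := near_right_dec hO hm hd (j z) dD.
    have [w [zw hw]] := h; have [m [zm mw]] := hdj zw.
    have /hD [x Px xm] := hw _ zm mw.
    by apply: nDz; apply/hD; exists x => //; ord hl.
  apply: (small_ev (a := j z) sY);
    apply: near_right_imp (near_right_and hm h (near_right_lt zy)).
  by move=> x _ [].
have [u bu] := lt_above hO b; have [z [bz zu]] := hdj bu.
have [s [hs hs']] : exists s, (forall y, lt y s -> Y y) /\ (forall y, lt s y -> ~ Y y).
  apply: (@cut_exists N hm Y (j x0) u).
  - by rewrite /Df1 /Y; dfi.
  - by move=> x y xy; apply: small_sub => w [wx nD]; split=> //; ord hl.
  - by apply: YD; apply/hD; exists x0 => //; exact: ltxx.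
  - by apply: (nYD z) => // /hD [x /hb xb]; apply; ord hl.
have se : lt (add s (opp (j e))) s.
  by rewrite -[X in lt _ X](addKN hO s (j e)); exact: add_ltxD.
have [m [sm ms]] := hdj se.
have /hD [x Px xm] : D (j m).
  apply: contrapT => nD; have [y [my ys]] := hd ms.
  by apply: (nYD m y nD my); exact: hs.
exists x => // y Py; have Yy : Y (j y) by apply: YD; apply/hD; exists y => //;
  exact: ltxx.
have ys : ~ lt s (j y) by move/hs'.
have := add_ltr hO (j e) sm; rewrite (addKN hO) => h1.
have [mx|<-] : lt (j m) (j x) \/ j m = j x by case: (nltP hl xm) => h; [left|right;
  rewrite h].
  by have := add_ltr hO (j e) mx => ?; ord hl.
by ord hl.
Qed.

(** Let [X] violate o-minimality. A break point outside [M] around which [X] is constant on [M] can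
    be discarded. If this applied to all break points outside [M], those in [M] would present [X] as
    a finite union. So at some [r] outside [M] the set [X] jumps, and the jump defines the cut. *)
Lemma definable_cut : ~ o_minimal R -> exists2 r : N, (forall m, j m <> r) &
  @Df _ S _ (fun a => a) unit (fun v => lt (j (v tt)) r).
Proof.
move=> nom.
have [X [dX hX]] : exists X : M -> Prop, @Df _ S _ (fun a => a) unit (fun v =>
  X (v tt)) /\
    ~ exists points intervals, forall x, X x <->
      List.In x points \/ exists2 J, List.In J intervals & in_interval (M := R) J x.
  apply: contrapT => no; apply: nom; split=> // X [phi hphi].
  apply: contrapT => hX; apply: no; exists X; split=> //.
  exists (fsubst (fun x => Var L match x with inl _ => inl tt | inr a =>
    inr a end) (unconst phi)).
  move=> v; rewrite sat_fsubst (hphi (fun _ => v tt)) sat_unconst.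
  by apply: sat_fvars => -[i|a].
have [D dD hD] : exists2 D, Df1 D & forall m, X m <-> D (j m).
  have [D0 dD0 hD0] := reduct_trace dX; exists (fun y => D0 (fun _ => y)).
    by apply: (Df_ext _ dD0) => v; suff -> : v = (fun _ => v tt) by [];
      apply: funext => -[].
  by move=> m; exact: (hD0 (fun _ => m)).
have [B hB] := breaks_exist hl hm dD.
pose removable r := exists al be, [/\ lt (j al) r, lt r (j be) &
  forall x y, lt (j al) (j x) -> lt (j x) (j y) -> lt (j y) (j be) -> (X x <-> X y)].
have [[r [rj nr]]|allr] := lem (exists r, (forall m, j m <> r) /\ ~ removable r).
  exists r => //.
  have [u0 ru0] := lt_above hO r; have [w0 wr0] := lt_below hO r.
  have [u [ru _ hu]] := avoid_right hm B ru0; have [w [wr _ hw]] := avoid_left hm B wr0.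
  have [al [wa ar]] := hdj wr; have [be [rb bu]] := hdj ru.
  have [x0 [ax0 x0r]] := hdj ar; have [y0 [ry0 y0b]] := hdj rb.
  have constl x y : lt (j al) (j x) -> lt (j x) (j y) -> lt (j y) r -> (X x <-> X y).
    move=> ax xy yr; rewrite !hD; apply: hB => // b /hw hb.
    have [bx|bx] := lem (lt b (j x)); [by left|right].
    by have [//|yb] := lem (lt (j y) b); case: hb; split; ord hl.
  have constr x y : lt r (j x) -> lt (j x) (j y) -> lt (j y) (j be) -> (X x <-> X y).
    move=> rx xy yb; rewrite !hD; apply: hB => // b /hu hb.
    have [bx|bx] := lem (lt b (j x)); [by left|right].
    by have [//|yb'] := lem (lt (j y) b); case: hb; split; ord hl.
  have cl x : lt (j al) (j x) -> lt (j x) r -> (X x <-> X x0).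
    move=> ax xr; have [h|[/(j_inj hj) ->//|h]] := lt_trich hl (j x) (j x0);
      first exact: constl.
    by apply: iff_sym; exact: constl.
  have cr x : lt r (j x) -> lt (j x) (j be) -> (X x <-> X y0).
    move=> rx xb; have [h|[/(j_inj hj) ->//|h]] := lt_trich hl (j x) (j y0);
      first exact: constr.
    by apply: iff_sym; exact: constr.
  have diff : ~ (X x0 <-> X y0).
    move=> e; apply: nr; exists al, be; split=> // x y ax xy yb.
    have hx : X x <-> X x0.
      have [xr|[/rj//|rx]] := lt_trich hl (j x) r; first exact: cl.
      by rewrite e; apply: cr => //; ord hl.
    rewrite hx; apply: iff_sym.
    have [yr|[/rj//|ry]] := lt_trich hl (j y) r; first by apply: cl => //; ord hl.
    by rewrite e; apply: cr => //; ord hl.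
  (* Between [al] and [be] the points below [r] are those that [X] treats like [x0], a point just
     left of [r]. *)
  apply: (Df_ext (P := fun v => @lt R (v tt) al \/ v tt = al \/
    (@lt R (v tt) be /\ (X (v tt) -> X x0) /\ (X x0 -> X (v tt))))).
    move=> v; move: (v tt) => m; rewrite !hlt; split=> [[h|[->//|[mb h]]]|mr].
    - by ord hl.
    - have [//|[/rj//|rm]] := lt_trich hl (j m) r.
      by case: diff; have := cr m rm mb; tauto.
    - have [h|[/(j_inj hj)|h]] := lt_trich hl (j m) (j al); [by left|by right;
      left|right; right].
      by split; [ord hl | have := cl m h mr; tauto].
  have tv : Tm (fun a : S => a) (fun v : unit -> S => v tt) by exact: Tm_var.
  have ta a : Tm (fun a : S => a) (fun v : unit -> S =>
    a) by exact: (@Tm_par _ S _ (fun a : S => a) unit a).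
  apply: Df_or; first exact: (@Df_lt R).
  apply: Df_or; first exact: Df_eq.
  apply: Df_and; first exact: (@Df_lt R).
  by apply: Df_and; apply: Df_imp => //; exact: Df_cst.
case: hX.
pose breaksM B := forall x y, lt (j x) (j y) ->
   (forall b, List.In b B -> lt b (j x) \/ lt (j y) b) -> (X x <-> X y).
(* Break points are moved to [C] if they come from [M] and dropped otherwise. *)
have [C hC] : exists C : seq M, breaksM (map j C).
  have : breaksM (B ++ map j [::]).
    move=> x y xy h; rewrite !hD; apply: hB => // b hb; apply: h; rewrite In_cat;
      by left.
  elim: B [::] {hB} => [|b B IH] C hC; first by exists C.
  have [[m hmb]|nb] := lem (exists m, j m = b).
    apply: (IH (m :: C)) => x y xy h; apply: hC => // c; rewrite /= In_cat => hc.
    by apply: h; rewrite In_cat /= hmb; tauto.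
  apply: (IH C) => x y xy h.
  have bm m : j m <> b by move=> hmb; apply: nb; exists m.
  have hC' x' y' : lt (j x') (j y') -> ~ lt (j x') (j x) -> ~ lt (j y) (j y') ->
      lt b (j x') \/ lt (j y') b -> (X x' <-> X y').
    move=> xy' xx yy hb; apply: hC => // c /= [<-//|/h [?|?]]; [left|right]; ord hl.
  have [bx|[/esym/bm//|xb]] := lt_trich hl b (j x); first by apply: hC' => //;
    [exact: ltxx|exact: ltxx|left].
  have [yb|[/bm//|by_]] := lt_trich hl (j y) b; first by apply: hC' => //;
    [exact: ltxx|exact: ltxx|right].
  have [al [be [ab bb hr]]] : removable b by apply: contrapT => hn; apply: allr;
    exists b.
  (* To cross [b], points [x'] and [y'] are taken on its two sides within the interval where [X] is
     constant. *)
  have [x' [xx' ax' x'b]] : exists x', [/\ lt (j x) (j x'), lt (j al) (j x') & lt (j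
    x') b].
    have [h1|h1] := lem (lt (j x) (j al)).
      by have [m [h2 h3]] := hdj ab; exists m; split=> //; ord hl.
    by have [m [h2 h3]] := hdj xb; exists m; split=> //; ord hl.
  have [y' [yy' by' y'b]] : exists y', [/\ lt (j y') (j y), lt (j y') (j be) & lt b
    (j y')].
    have [h1|h1] := lem (lt (j be) (j y)).
      by have [m [h2 h3]] := hdj bb; exists m; split=> //; ord hl.
    by have [m [h2 h3]] := hdj by_; exists m; split=> //; ord hl.
  have e1 : X x <-> X x' by apply: hC' => //; [exact: ltxx|ord hl|right].
  have e2 : X x' <-> X y' by apply: hr => //; ord hl.
  have e3 : X y' <-> X y by apply: hC' => //; [ord hl|exact: ltxx|left].
  tauto.
have [|pts [ivs h]] := @finite_union R hR X C None None.
  move=> x y _ _ /hlt xy hb; apply: hC =>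
    // b' /List.in_map_iff [b [<- /hb [/hlt|/hlt]]]; by auto.
exists pts, ivs => x; rewrite -h; split=> [|[]//].
by move=> Xx; split=> //; split.
Qed.

Lemma reduct_no_atomic : ~ o_minimal R -> ~ has_atomic_models_over_sets (Th S).
Proof.
move=> nom hat; have [r rj dC] := definable_cut nom.
have [U [hU FU]] := ultraFilterLemma (fastF_filter hO hm hdj).
have Upos : U (fun e => forall n, pos j (e n)) by apply: FU; exact: (fastF_pos hO hdj).
(* The infinitesimals are the coordinates [e n]; [P] is the interval from [r - e 0] up to [r],
   written without naming [r]. *)
pose P (e : nat -> M) x := lt (j x) r /\ ~ lt (j (@add R x (e 0))) r.
have dP : @Df2 _ S _ (fun a => a) nat P.
  apply: Df_and; first by apply: (Df_subst (t := fun _ v => v None) dC) => _;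
    exact: Tm_var.
  apply: Df_not; apply: (Df_subst (t := fun _ v =>
    @add R (v None) (v (Some 0))) dC) => _.
  by apply: (@Tm_add R); exact: Tm_var.
have exP : U (fun e => exists x, P e x).
  apply: U_sub Upos => // e epos.
  have h : lt (add r (opp (j (e 0)))) r.
    by rewrite -[X in lt _ X](addKN hO r (j (e 0))); apply: add_ltxD => //; exact: epos.
  have [x [rx xr]] := hdj h; exists x; split=> //; rewrite hadd.
  by have := add_ltr hO (j (e 0)) rx; rewrite (addKN hO) => ? ?; ord hl.
have [Q [dQ exQ QP comp]] := @complete_formula L S U hU P hat dP exP.
have [n hn] := Df2_depends dQ.
pose two e := exists x y, [/\ Q e x, Q e y & lt (j x) (j y)].
have [h2|/(U_not hU) h1] := lem (U two).
  (* [Q] sees only coordinates below [n], so [e n] may be taken smaller than the distance between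
     two of its solutions. [G] asks for a solution at or beyond [x + e n]. *)
  pose G (e : nat -> M) x := exists y, Q e y /\ ~ @lt R y (@add R x (e n)).
  have dG : @Df2 _ S _ (fun a => a) nat G.
    apply: Df_ex; apply: Df_and.
      by apply: (Df2_app dQ) => [x|]; exact: Tm_var.
    by apply: Df_not; apply: (@Df_lt R); [exact: Tm_var | apply: (@Tm_add R);
      exact: Tm_var].
  have gap : U (fun e => two e -> exists x, Q e x /\ G e x).
    apply: FU; apply: (@fastF_step N hO hm M j hdj n (fun _ => True)); [by []| | |].
    - move=> e e' ee' h [x [y [Qx Qy xy]]].
      have back z : Q e' z -> Q e z by apply: hn => i hi; rewrite ee' // ltnW.
      have forth z : Q e z -> Q e' z by apply: hn => i hi; rewrite ee' // ltnW.
      have [|x' [Qx' [y' [Qy' hy']]]] := h; first by exists x, y; split=> //;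
        exact: back.
      exists x'; split; first exact: forth.
      by exists y'; split; [exact: forth | rewrite -ee'].
    - move=> e _; have [[x [y [Qx Qy xy]]]|no] := lem (two e).
        have [d [d0 dxy]] : exists d, pos j d /\ lt (j d) (add (opp (j x)) (j y)).
          by apply: pos_below => //; rewrite -(addN hO (j x)); exact: add_ltl.
        exists d; split=> // t t0 td _.
        have forth z : Q e z -> Q (upd e n t) z.
          by apply: hn => i hi; rewrite /upd ltn_eqF.
        exists x; split; first exact: forth.
        exists y; split; first exact: forth.
        rewrite /upd eqxx => /hlt; rewrite hadd => h.
        have : lt (add (j x) (j t)) (j y).
          by rewrite -(addNK hO (j x) (j y)); apply: (add_ltl hO); ord hl.
        by move=> ?; ord hl.
      have [d [d0 _]] := pos_below hdj (zero_one hO).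
      exists d; split=> // t _ _ [x [y [Qx Qy xy]]]; case: no.
      have back z : Q (upd e n t) z -> Q e z.
        by apply: hn => i hi; rewrite /upd ltn_eqF.
      by exists x, y; split=> //; exact: back.
    - by apply: fastF_sub (fastF_pos hO hdj).
  (* Completeness makes [G] hold at all solutions or at none, and [gap] excludes the latter; the
     former contradicts [definable_sup]. *)
  have [hG|hG] := comp G dG; last first.
    have := U_and hU (U_and hU h2 gap) hG;
      apply: U_false => // e [[he /(_ he) [x [Qx Gx]]] /(_ x Qx)].
    by apply.
  have := U_and hU (U_and hU Upos hG) (U_and hU exQ QP).
  apply: U_false => // e [[epos allG] [[x0 Qx0] allP]].
  have [||||x Qx hx] := @definable_sup (Q e) r (e n).
  - by apply: (@Df2_app _ S _ (fun a : S => a) nat unit Q (fun i _ => e i) (fun v =>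
    v tt) dQ) => [i|]; [exact: (@Tm_par _ S _ (fun a : S => a)) | exact: Tm_var].
  - by exists x0.
  - by move=> x /allP [].
  - exact: epos.
  have [y [Qy]] := allG x Qx; apply; apply/hlt; rewrite hadd; exact: hx.
(* [Q] has a single solution at almost all indices only; [single] enforces uniqueness at each. *)
pose single (e : nat -> M) x := Q e x /\ forall y, Q e y -> y = x.
have dsingle : @Df2 _ S _ (fun a => a) nat single.
  apply: Df_and => //; apply: Df_all; apply: Df_imp.
    by apply: (Df2_app dQ) => [x|]; exact: Tm_var.
  by apply: Df_eq; exact: Tm_var.
have [D dD hD] := reduct_trace dsingle.
have [E dE hE] : exists2 E, Df2 (fun a : N => a) E & forall e x,
    single e x <-> E (fun i => j (e i)) (j x).
  exists (fun v y => D (oapp v y)).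
    apply: (Df_ext _ dD) => v; suff -> : v = oapp (fun x => v (Some x)) (v None) by [].
    by apply: funext => -[].
  move=> e x; rewrite -[single e x]/(single (fun i =>
    oapp e x (Some i)) (oapp e x None)) hD.
  suff -> : (fun y => j (oapp e x y)) = oapp (fun i => j (e i)) (j x) by [].
  by apply: funext => -[].
(* [E] is known only at points of [M], so smallness is imposed where [base_cover] requires it for
   all valuations in [N]. *)
have [||E1 [dE1 sE1 hE1]] := @base_cover N hO hm M j hdj nat (fun v y =>
  E v y /\ small (E v)).
- by dfi.
- by move=> v [p [q [pq h]]]; have [x [px xq]] := hd pq; have [_] := h x px xq; apply;
    exists p, q; split=> // y py yq; have [] := h y py yq.
have [k hk] := Df2_depends dE1.
have av := @fastF_avoid N hO hm M j hj hdj r E1 k rj dE1 sE1.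
have {}av := FU _ (av (fun y v v' hv => hk y v v' (fun i hi => hv i (ltnW hi)))).
have := U_and hU (U_and hU av h1) (U_and hU exQ QP).
apply: U_false => // e [[avE no2] [[x Qx] allP]].
have ux : single e x.
  split=> // y Qy; have [h|[/(j_inj hj)//|h]] := lt_trich hl (j y) (j x).
    by case: no2; exists y, x.
  by case: no2; exists x, y.
have [xr xer] := allP x Qx; rewrite hadd in xer.
apply: (avE (j x)).
- move=> h; apply: xer.
  by have := add_ltr hO (j (e 0)) h; rewrite (addKN hO).
- by move=> h; ord hl.
apply: hE1; split; first exact/hE.
(* An interval inside [E] would contain two points of [M], giving two solutions of [Q]. *)
move=> [p [q [pq h]]]; have [m1 [pm1 m1q]] := hdj pq; have [m2 [mm m2q]] := hdj m1q.
have /hE [Q1 _] := h _ pm1 m1q.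
have /hE [Q2 _] : E (fun i => j (e i)) (j m2) by apply: h => //; ord hl.
by apply: no2; exists m1, m2.
Qed.

End Reduct.

Theorem proposition4 (T M : og_structure) (hT : o_minimal_trace T)
    (hM : ordered_group_reduct M T) (hstrict : ~ o_minimal M) :
  ~ has_atomic_models_over_sets (Th M).
Proof.
case: hT => N [M0 [j [[hO hm] hj _ hdj eT]]]; subst T.
case: M hM hstrict => L g S hM nom.
case: hM => i [eg eS]; simpl in i, eg, eS; subst S.
apply: (@reduct_no_atomic N hO hm M0 j hj hdj L g
  (fun n f => fint (trace j) (fincl i f)) (fun n r => rint (trace j) (rincl i r))) =>
    //.
- move=> x y; rewrite /lt /=.
  have -> : rincl i (og_lt g) = inl (og_lt (ogs N)) by have := congr1 (@og_lt _) eg.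
  rewrite (j_rint hj); suff -> : (fun k => j (tnth [tuple x;
    y] k)) = tnth [tuple j x; j y] by [].
  by apply: funext => -[[|[|k]] hk].
- move=> x y; rewrite /add /=.
  have -> : fincl i (og_add g) = og_add (ogs N) by have := congr1 (@og_add _) eg.
  rewrite (j_fint hj); congr (fint N _ _).
  by apply: funext => -[[|[|k]] hk].
- move=> V phi; have [P dP hP] := trace_definable hO hm hj hdj (lmap i phi).
  by exists P => // v; rewrite -hP -sat_lmap.
Qed.
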